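(* For $n\in\mathbb{Z}^+$, let $Q_t(n)$ be the number in system of an infinite server queue with batch arrivals where the batch size is drawn from the i.i.d. sequence $\{N_i\mid i\in\mathbb{Z}^+\}$. Let $n\lambda>0$ be the arrival rate and let $\mu>0$ be the rate of exponentially distributed service. Then the limiting moment generating function of the fluid scaling is given by $$\lim_{n\to\infty}\mathbb{E}\left[e^{\frac{\theta}{n}Q_t(n)}\right]=e^{\frac{\lambda\mathbb{E}[N_1]\theta}{\mu}\left(1-e^{-\mu t}\right)+Q_0\theta e^{-\mu t}}$$ for all $t\ge0$.
   Context: Model: for each $n$, batches arrive at the epochs of a Poisson process of rate $n\lambda$, the $i$-th batch bringing $N_i$ customers simultaneously. There are infinitely many servers, so each customer starts service immediately and leaves after an independent exponentially distributed service time of rate $\mu$; the batch sizes are independent of the queue. $Q_t(n)$ is the number of customers present at time $t$. The symbol $Q_0$ denotes the initial value, in the sense of the displayed formula at $t=0$: the limiting moment generating function at time $0$ is $e^{Q_0\theta}$.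
   Formalization: The formal theorem adds that N_1 is integrable and that E[exp(θN_1/m)] is finite for some m ≥ 1; for θ > 0 and t > 0 the latter is necessary, since otherwise E[exp(θQ_t(n)/n)] is infinite for every n. *)

(* Defs.v *)
From HB Require Import structures.
From mathcomp Require Import all_boot all_order all_algebra finmap.
From mathcomp Require Import all_classical all_reals all_analysis.

Set Implicit Arguments.
Unset Strict Implicit.
Unset Printing Implicit Defensive.

Import Order.TTheory GRing.Theory Num.Theory.
Import numFieldNormedType.Exports.

Local Open Scope classical_set_scope.
Local Open Scope ring_scope.

Definition mutually_independent (d : measure_display) (T : measurableType d)
    (R : realType) (P : probability T R) (I : choiceType)
    (F : I -> set_system T) : Prop :=
  forall (J : {fset I}) (E : I -> set T),
    (forall i, i \in J -> F i (E i)) ->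
    P (\bigcap_(i in [set` J]) E i) = (\prod_(i <- J) P (E i))%E.

Definition events_of (d d' : measure_display) (T : measurableType d)
    (T' : measurableType d') (X : T -> T') : set_system T :=
  preimage_set_system setT X measurable.

(* Laws are compared on measurable sets only: outside its sigma-algebra, a
   measure of the library takes arbitrary values. *)
Definition same_law (d : measure_display) (T : measurableType d) (R : realType)
    (p q : set T -> \bar R) : Prop :=
  forall A, measurable A -> p A = q A.

Definition iid (d d' : measure_display) (T : measurableType d)
    (T' : measurableType d') (R : realType) (P : probability T R)
    (X : nat -> {RV P >-> T'}) : Prop :=
  mutually_independent P (fun i => events_of (X i)) /\
  forall i, same_law (distribution P (X i)) (distribution P (X 0%N)).

(* Batches and customers are numbered from 0.  [service q i j] is the service
   time of the j-th customer of the i-th batch, and [initial_service q k] the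
   residual service time of the k-th customer present at time 0. *)
Record queue_input (d : measure_display) (T : measurableType d) (R : realType)
    (P : probability T R) := QueueInput {
  interarrival : nat -> {RV P >-> R};
  service : nat -> nat -> {RV P >-> R};
  initial_size : {RV P >-> nat};
  initial_service : nat -> {RV P >-> R} }.

Inductive source :=
  | Interarrival of nat
  | BatchSize of nat
  | Service of nat & nat
  | InitialSize
  | InitialService of nat.

HB.instance Definition _ := gen_eqMixin source.
HB.instance Definition _ := gen_choiceMixin source.

Definition source_events (d : measure_display) (T : measurableType d)
    (R : realType) (P : probability T R) (N : nat -> {RV P >-> nat})
    (q : queue_input P) (s : source) : set_system T :=
  match s with
  | Interarrival i => events_of (interarrival q i)
  | BatchSize i => events_of (N i)
  | Service i j => events_of (service q i j)
  | InitialSize => events_of (initial_size q)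
  | InitialService k => events_of (initial_service q k)
  end.

(* The arrival epochs form a Poisson process of rate [rate]: its gaps, the
   first one counted from time 0, are i.i.d. exponential of rate [rate].  The
   residual services at time 0 are exponential of rate [mu] by absence of
   memory. *)
Record batch_arrival_queue (d : measure_display) (T : measurableType d)
    (R : realType) (P : probability T R) (rate mu : R)
    (N : nat -> {RV P >-> nat}) (q : queue_input P) : Prop := {
  interarrival_exponential : forall i,
    same_law (distribution P (interarrival q i)) (exponential_prob rate);
  service_exponential : forall i j,
    same_law (distribution P (service q i j)) (exponential_prob mu);
  initial_service_exponential : forall k,
    same_law (distribution P (initial_service q k)) (exponential_prob mu);
  sources_independent : mutually_independent P (source_events N q) }.

Definition arrival_epoch (d : measure_display) (T : measurableType d)
    (R : realType) (P : probability T R) (q : queue_input P)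
    (i : nat) (w : T) : R :=
  \sum_(k < i.+1) interarrival q k w.

Definition initial_still_present (d : measure_display) (T : measurableType d)
    (R : realType) (P : probability T R) (q : queue_input P)
    (t : R) (w : T) : nat :=
  (\sum_(k < initial_size q w) (t < initial_service q k w)%R)%N.

Definition batch_still_present (d : measure_display) (T : measurableType d)
    (R : realType) (P : probability T R) (N : nat -> {RV P >-> nat})
    (q : queue_input P) (i : nat) (t : R) (w : T) : nat :=
  if arrival_epoch q i w <= t then
    (\sum_(j < N i w) (t < arrival_epoch q i w + service q i j w)%R)%N
  else 0%N.

(* The sum over the batches is an extended real; it is infinite at most on the
   null event that infinitely many batches arrive before [t], where [fine]
   returns 0. *)
Definition number_in_system (d : measure_display) (T : measurableType d)
    (R : realType) (P : probability T R) (N : nat -> {RV P >-> nat})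
    (q : queue_input P) (t : R) (w : T) : R :=
  fine ((initial_still_present q t w)%:R%:E +
        \sum_(0 <= i <oo) (batch_still_present N q i t w)%:R%:E)%E.

(* Main.v *)
Require Import Defs.
From HB Require Import structures.
From mathcomp Require Import all_boot all_order all_algebra finmap.
From mathcomp Require Import all_classical all_reals all_analysis.
From mathcomp Require Import measurable_realfun.
From mathcomp Require Import ring lra.

Set Implicit Arguments.
Unset Strict Implicit.
Unset Printing Implicit Defensive.

Import Order.TTheory GRing.Theory Num.Theory.
Import numFieldNormedType.Exports.

Local Open Scope classical_set_scope.
Local Open Scope ring_scope.

(** Given the arrival epochs, each customer present at time [0] or arrived since
    is still there at time [t] independently of the others, with a probability
    exponential in the time elapsed.  Summing over the customers of a group of
    independent random size [M] turns [E e^(s * survivors)] into the generating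
    function [E r^M] with [r = 1 + p (e^s - 1)], where [p] is the survival
    probability of one customer ([integral_thinned]).

    For the batches, let [h y] be that generating function for a batch which
    arrived [y] units of time ago, [nu] the arrival rate, and [H] the
    antiderivative of [nu * h] that vanishes at [0].  Restarting the process at
    its first arrival gives a recursion on the number [K] of batches arrived by
    time [x], whose solution is
    [E (e^(s * survivors); K arrivals) = e^(- nu x) (H x)^K / K!]
    ([expected_path_weight]).  Summing over [K] gives
    [E e^(s Q_t) = E r^(Q_0) * e^(H t - nu t)] ([mgf_number_in_system]).  The
    case [s = 0] shows that almost surely only finitely many batches arrive
    before [t].

    With [nu = n lambda] and [s = theta / n], the exponent [H t - nu t] is
    [lambda] times the integral over [0, t] of [n (h y - 1)].  Since
    [n (r^M - 1)] tends to [p theta M], two dominated convergences, over the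
    batch size and over the age [y], give the limit
    [lambda E[N] theta (1 - e^(- mu t)) / mu] ([cvg_Rintegral_batch_pgf]).  As
    for the initial customers, [r] lies between [e^((p theta - e) / n)] and
    [e^((p theta + e) / n)] for large [n], so [E r^(Q_0(n))] is squeezed between
    values of the scaled generating function at time [0], which converges by
    assumption ([cvg_integral_thinning_factor]). *)

(** * Independence of groups of sources *)

Section independence.
Local Open Scope ereal_scope.
Context d (T : measurableType d) (R : realType) (P : probability T R).

Definition independent_systems (G H : set_system T) : Prop :=
  forall A B, G A -> H B -> P (A `&` B) = P A * P B.

Lemma independent_systemsC (G H : set_system T) :
  independent_systems G H -> independent_systems H G.
Proof. by move=> GH A B HA GB; rewrite setIC GH// muleC. Qed.

(** For a fixed [B] in [H], the finite measures [A |-> P (A `&` B)] and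
    [A |-> P A * P B] agree on the pi-system [G], hence on the sigma-algebra
    that it generates. *)
Lemma independent_sigmal (G H : set_system T) :
  G `<=` measurable -> H `<=` measurable -> setI_closed G -> G setT ->
  independent_systems G H -> independent_systems <<s G >> H.
Proof.
move=> Gm Hm GI GT GH A B sGA HB.
have mB := Hm _ HB.
have PBfin : P B \is a fin_num by exact: fin_num_measure.
pose k : {nonneg R} := NngNum (fine_ge0 (measure_ge0 P B)).
have cover : \bigcup_(_ in [set: nat]) [set: T] = setT.
  by apply: bigcup_const; exists 0%N.
have kE C : mscale k P C = P C * P B.
  by rewrite /mscale /= -[in LHS]muleC; congr (_ * _); rewrite -[RHS]fineK.
rewrite -kE -/(mrestr P mB A).
apply: (@g_sigma_algebra_measure_unique _ R T G Gm (fun=> setT) (fun=> GT)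
  cover (mrestr P mB) (mscale k P) GI) => //.
  by move=> C GC; transitivity (P C * P B); [exact: GH|exact/esym/kE].
move=> _; rewrite /= /mrestr setTI.
by rewrite (le_lt_trans (probability_le1 P mB))// ltry.
Qed.

Lemma independent_sigma (G H : set_system T) :
  G `<=` measurable -> H `<=` measurable -> setI_closed G -> setI_closed H ->
  G setT -> H setT ->
  independent_systems G H -> independent_systems <<s G >> <<s H >>.
Proof.
move=> Gm Hm GI HI GT HT GH.
have sGm : <<s G >> `<=` measurable.
  by apply: smallest_sub => //; exact: sigma_algebra_measurable.
apply: independent_systemsC; apply: independent_sigmal => //.
by apply: independent_systemsC; exact: independent_sigmal.
Qed.

End independence.

Section grouping.
Local Open Scope ereal_scope.
Context d (T : measurableType d) (R : realType) (P : probability T R).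
Context (I : choiceType) (F : I -> set_system T).

(** A pi-system that generates the sigma-algebra of the information carried by
    the sources in [J]; unlike that sigma-algebra it is described by finitely
    many events at a time, which is the form of [mutually_independent]. *)
Definition finite_intersections (J : set I) : set_system T :=
  [set A | exists (K : {fset I}) (E : I -> set T),
    (forall i, i \in K -> J i /\ F i (E i)) /\
    A = \bigcap_(i in [set` K]) E i].

Lemma finite_intersectionsT (J : set I) : finite_intersections J setT.
Proof.
exists fset0, (fun=> setT); split=> [i|]; first by rewrite inE.
by apply/seteqP; split=> // x _ i /=; rewrite inE.
Qed.

Lemma sub_finite_intersections (J : set I) i :
  J i -> F i `<=` finite_intersections J.
Proof.
move=> Ji A FA; exists [fset i]%fset, (fun=> A); split.
  by move=> j /[!inE] /eqP ->.
apply/seteqP; split=> [x Ax j//|x]; apply => /=.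
by rewrite inE.
Qed.

Lemma finite_intersections_measurable (J : set I) :
  (forall i, J i -> F i `<=` measurable) ->
  finite_intersections J `<=` measurable.
Proof.
move=> mF _ [K [E [KE ->]]].
apply: fin_bigcap_measurable; first exact: finite_fset.
by move=> i /= /KE[Ji]; exact: mF.
Qed.

Hypothesis F_sigma : forall i, sigma_algebra setT (F i).

Let FT i : F i setT.
Proof. by have [F0 FC _] := F_sigma i; rewrite -(setD0 setT); exact: FC. Qed.

Let FI i : setI_closed (F i).
Proof.
by have /(sigma_algebraP (fun A _ => @subsetT _ A))[] := F_sigma i.
Qed.

Lemma finite_intersections_setI (J : set I) :
  setI_closed (finite_intersections J).
Proof.
move=> _ _ [K1 [E1 [h1 ->]]] [K2 [E2 [h2 ->]]].
pose E1' i := if i \in K1 then E1 i else setT.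
pose E2' i := if i \in K2 then E2 i else setT.
exists (K1 `|` K2)%fset, (fun i => E1' i `&` E2' i); split.
  move=> i; rewrite in_fsetU => iK; split.
    by case/orP: iK => [/h1|/h2] [].
  apply: FI; rewrite /E1' /E2'; case: ifPn => //.
    by move/h1 => -[].
  by move/h2 => -[].
apply/seteqP; split=> [x [h h'] i /=|x h].
  rewrite in_fsetU => _; rewrite /E1' /E2'.
  by split; case: ifPn => // iK; [exact: h|exact: h'].
split=> i /= iK.
  have [] := h i; first by rewrite /= in_fsetU iK.
  by rewrite /E1' iK.
have [] := h i; first by rewrite /= in_fsetU iK orbT.
by rewrite /E2' iK.
Qed.

Hypothesis F_measurable : forall i, F i `<=` measurable.
Hypothesis F_indep : mutually_independent P F.

Lemma independent_finite_intersections (J1 J2 : set I) : [disjoint J1 & J2] ->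
  independent_systems P (finite_intersections J1) (finite_intersections J2).
Proof.
move=> /disj_setPRL J12 _ _ [K1 [E1 [h1 ->]]] [K2 [E2 [h2 ->]]].
have K12 i : i \in K1 -> i \notin K2.
  by move=> /h1[J1i _]; apply/negP => /h2[/J12]; exact.
pose E i := if i \in K1 then E1 i else E2 i.
have EE1 i : i \in K1 -> E i = E1 i by rewrite /E => ->.
have EE2 i : i \in K2 -> E i = E2 i.
  by rewrite /E; case: ifPn => // /K12 /negbTE ->.
have -> : \bigcap_(i in [set` K1]) E1 i `&` \bigcap_(i in [set` K2]) E2 i =
          \bigcap_(i in [set` (K1 `|` K2)%fset]) E i.
  rewrite set_fsetU bigcap_setU; congr (_ `&` _); apply: eq_bigcapr => i /=.
    by move/EE1 ->.
  by move/EE2 ->.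
rewrite F_indep; last first.
  move=> i; rewrite in_fsetU => /orP[iK|iK].
    by rewrite EE1//; have [] := h1 _ iK.
  by rewrite EE2//; have [] := h2 _ iK.
rewrite F_indep; last by move=> i /h1[].
rewrite F_indep; last by move=> i /h2[].
have K12perm : perm_eq (K1 `|` K2)%fset (K1 ++ K2).
  apply: uniq_perm => //.
    rewrite cat_uniq !fset_uniq /= andbT.
    by apply/hasPn => i iK2; apply/negP => /K12; rewrite iK2.
  by move=> i; rewrite mem_cat in_fsetU.
rewrite (perm_big _ K12perm) big_cat/=; congr (_ * _).
  by rewrite !big_seq; apply: eq_bigr => i iK; rewrite EE1.
by rewrite !big_seq; apply: eq_bigr => i iK; rewrite EE2.
Qed.

(** Disjoint sets of independent sources carry independent information: the
    product rule holds on finite intersections, and extends to the generated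
    sigma-algebras by applying the pi-system argument on each side. *)
Lemma independent_groups (J1 J2 : set I) : [disjoint J1 & J2] ->
  independent_systems P <<s finite_intersections J1 >>
                        <<s finite_intersections J2 >>.
Proof.
move=> J12; apply: independent_sigma.
- exact: finite_intersections_measurable.
- exact: finite_intersections_measurable.
- exact: finite_intersections_setI.
- exact: finite_intersections_setI.
- exact: finite_intersectionsT.
- exact: finite_intersectionsT.
- exact: independent_finite_intersections.
Qed.

End grouping.

(** * Averaging with an independent variable frozen *)

Section freezing.
Local Open Scope ereal_scope.
Context d (T : measurableType d) (R : realType) (P : probability T R).

(** The part of a random experiment that is independent of [X] may be averaged
    with [X] frozen.  The pair of [X] and of the identity, seen as a variable
    with values in [T] equipped with the sigma-algebra of [G], has a product
    law by independence, and Tonelli's theorem applies to it. *)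
Lemma ge0_integral_independent d1 (T1 : measurableType d1) (G : set_system T)
    (Gm : G `<=` measurable) (X : {RV P >-> T1})
    (F : (T1 * g_sigma_algebraType G)%type -> \bar R) :
  independent_systems P (events_of X) <<s G >> ->
  measurable_fun setT F -> (forall z, 0 <= F z) ->
  \int[P]_w F (X w, w) = \int[distribution P X]_x \int[P]_w F (x, w).
Proof.
move=> XG mF F0.
have sGm : <<s G >> `<=` measurable.
  by apply: smallest_sub => //; exact: sigma_algebra_measurable.
pose T' := g_sigma_algebraType G.
pose i := fun w : T => (w : T').
have mi : measurable_fun setT i.
  by move=> _ A mA; rewrite setTI; exact: sGm.
pose iRV : {RV P >-> T'} := HB.pack i (isMeasurableFun.Build _ _ _ _ i mi).
pose j := fun w : T => (X w, i w).
have mj : measurable_fun setT j by exact: measurable_fun_pair.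
pose jRV : {RV P >-> (T1 * T')%type} :=
  HB.pack j (isMeasurableFun.Build _ _ _ _ j mj).
transitivity (\int[distribution P jRV]_z F z).
  by rewrite ge0_integral_distribution.
rewrite (@eq_measure_integral _ _ _ _ (distribution P X \x distribution P iRV));
    last first.
  move=> A mA _; apply/esym; apply: product_measure_unique => // B C mB mC.
  rewrite /distribution /pushforward/=.
  rewrite -(XG (X @^-1` B) C)//.
  by exists B => //; rewrite setTI.
rewrite fubini_tonelli1//; apply: eq_integral => x _.
rewrite /fubini_F ge0_integral_distribution//.
exact: measurableT_comp.
Qed.

(** Freezing the identity itself, as a variable with values in [T] equipped
    with the sigma-algebra of [G]. *)
Lemma ge0_integral_independentM (G H : set_system T)
    (Gm : G `<=` measurable) (Hm : H `<=` measurable)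
    (U : g_sigma_algebraType G -> \bar R)
    (V : g_sigma_algebraType H -> \bar R) :
  independent_systems P <<s G >> <<s H >> ->
  measurable_fun setT U -> measurable_fun setT V ->
  (forall w, 0 <= U w) -> (forall w, 0 <= V w) ->
  \int[P]_w (U w * V w) = \int[P]_w U w * \int[P]_w V w.
Proof.
move=> GH mU mV U0 V0.
have sm (K : set_system T) : K `<=` measurable -> <<s K >> `<=` measurable.
  by move=> Km; apply: smallest_sub => //; exact: sigma_algebra_measurable.
pose T' := g_sigma_algebraType G.
pose i := fun w : T => (w : T').
have mi : measurable_fun setT i.
  by move=> _ A mA; rewrite setTI; exact: (sm _ Gm).
pose iRV : {RV P >-> T'} := HB.pack i (isMeasurableFun.Build _ _ _ _ i mi).
have mV' : @measurable_fun _ _ T _ setT V.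
  by move=> _ A mA; apply: (sm _ Hm); exact: mV.
have mU' : @measurable_fun _ _ T _ setT U.
  by move=> _ A mA; apply: (sm _ Gm); exact: mU.
pose F (z : (T' * g_sigma_algebraType H)%type) := U z.1 * V z.2.
have -> : \int[P]_w (U w * V w) = \int[P]_w F (iRV w, w) by [].
rewrite ge0_integral_independent//; last 3 first.
- move=> A B [C mC <-]; rewrite setTI; exact: GH.
- by apply: emeasurable_funM; exact: measurableT_comp.
- by move=> z; exact: mule_ge0.
rewrite /F/=; under eq_integral do rewrite ge0_integralZl//.
rewrite ge0_integralZr//; last by apply: integral_ge0.
by rewrite ge0_integral_distribution.
Qed.

Lemma measurable_events_of d1 (T1 : measurableType d1) (G : set_system T)
    (X : T -> T1) : events_of X `<=` G ->
  measurable_fun setT (X : g_sigma_algebraType G -> T1).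
Proof.
by move=> XG _ A mA; apply: sub_sigma_algebra; apply: XG; exists A.
Qed.

End freezing.

Section events_of.
Context d (T : measurableType d) d1 (T1 : measurableType d1).

Lemma sigma_algebra_events_of (X : T -> T1) : sigma_algebra setT (events_of X).
Proof. exact: sigma_algebra_preimage (sigma_algebra_measurable T1). Qed.

Lemma events_of_measurable (X : {mfun T >-> T1}) :
  events_of X `<=` measurable.
Proof. by move=> _ [A mA <-]; exact: measurable_funP. Qed.

End events_of.

(** * The thinning factor *)

Section thinning_factor_bounds.
Context (R : realType).
Implicit Types (p s x : R).

(** The moment generating function at [s] of a Bernoulli variable with
    parameter [p]. *)
Definition thinning_factor p s : R := 1 + p * (expR s - 1).

Lemma thinning_factor_ge0 p s : 0 <= p <= 1 -> 0 <= thinning_factor p s.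
Proof.
move=> /andP[p0 p1]; rewrite /thinning_factor mulrBr mulr1 addrCA.
by rewrite addr_ge0 ?subr_ge0 ?mulr_ge0 ?expR_ge0.
Qed.

Lemma thinning_factor_gt0 p s : 0 <= p <= 1 -> 0 < thinning_factor p s.
Proof.
move=> /andP[p0 p1]; have [->|pN0] := eqVneq p 0.
  by rewrite /thinning_factor mul0r addr0.
rewrite /thinning_factor mulrBr mulr1 addrCA ltr_pwDl ?subr_ge0//.
by rewrite mulr_gt0 ?expR_gt0// lt_neqAle eq_sym pN0.
Qed.

Lemma thinning_factor_le p s : 0 <= p <= 1 -> 0 <= s ->
  1 <= thinning_factor p s <= expR s.
Proof.
move=> /andP[p0 p1] s0.
have es : 0 <= expR s - 1 by rewrite subr_ge0 -expR0 ler_expR.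
rewrite /thinning_factor lerDl mulr_ge0//=.
by rewrite -lerBrDl -[leRHS]mul1r ler_wpM2r.
Qed.

Lemma thinning_factor_ge p s : 0 <= p <= 1 -> s <= 0 ->
  expR s <= thinning_factor p s <= 1.
Proof.
move=> /andP[p0 p1] s0.
have es : 0 <= 1 - expR s by rewrite subr_ge0 -expR0 ler_expR.
rewrite /thinning_factor -opprB mulrN gerBl mulr_ge0// andbT.
by rewrite lerBrDl -lerBrDr -[leRHS]mul1r ler_wpM2r.
Qed.

Lemma expRN_itv01 x : 0 <= x -> 0 <= expR (- x) <= 1.
Proof. by move=> x0; rewrite expR_ge0 -[leRHS]expR0 ler_expR oppr_le0. Qed.

End thinning_factor_bounds.

(** * Measurability of randomly indexed sums *)

Section measurability.
Context d (U : measurableType d) (R : realType).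

(** The preimage of a measurable set splits along the countably many values of
    [M]. *)
Lemma measurable_nat_index d' (V : measurableType d') (M : U -> nat)
    (g : nat -> U -> V) : measurable_fun setT M ->
  (forall m, measurable_fun setT (g m)) ->
  measurable_fun setT (fun w => g (M w) w).
Proof.
move=> mM mg _ A mA; rewrite setTI.
have -> : (fun w => g (M w) w) @^-1` A =
    \bigcup_m (M @^-1` [set m] `&` g m @^-1` A).
  apply/seteqP; split=> [w Aw|w [m _ [/= <-]]//].
  by exists (M w).
apply: bigcupT_measurable => m; apply: measurableI.
  by rewrite -[X in measurable X]setTI; exact: mM.
by rewrite -[X in measurable X]setTI; exact: mg.
Qed.

Lemma measurable_bool_natr (b : U -> bool) : measurable_fun setT b ->
  measurable_fun setT (fun w => (b w)%:R : R).
Proof.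
move=> mb; apply: (measurableT_comp (f := fun b : bool => b%:R : R)) => //.
Qed.

Lemma measurable_thinned_sum (y : U -> R) (M : U -> nat) (X : nat -> U -> R) :
  measurable_fun setT y -> measurable_fun setT M ->
  (forall j, measurable_fun setT (X j)) ->
  measurable_fun setT
    (fun w => (\sum_(j < M w) (y w < X j w)%R)%N%:R : R).
Proof.
move=> my mM mX.
apply: (measurable_nat_index
  (g := fun m w => (\sum_(j < m) (y w < X j w)%R)%N%:R : R)) => // m.
under eq_fun do rewrite natr_sum.
by apply: measurable_sum => j; exact/measurable_bool_natr/measurable_fun_ltr.
Qed.

Lemma measurable_thinned_exp (s : R) (y : U -> R) (M : U -> nat)
    (X : nat -> U -> R) :
  measurable_fun setT y -> measurable_fun setT M ->
  (forall j, measurable_fun setT (X j)) ->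
  measurable_fun setT
    (fun w => expR (s * (\sum_(j < M w) (y w < X j w)%R)%N%:R)).
Proof.
move=> my mM mX; apply: measurableT_comp => //.
by apply: measurable_funM => //; exact: measurable_thinned_sum.
Qed.

Lemma measurable_exceeds (X : U -> R) (y : R) : measurable_fun setT X ->
  measurable [set w | y < X w].
Proof.
by move=> mX; rewrite -[X in measurable X]setTI; exact: measurable_fun_ltr.
Qed.

End measurability.

(** * Survivors among a random number of customers *)

Section thinning.
Local Open Scope ereal_scope.
Context d (T : measurableType d) (R : realType) (P : probability T R).
Context (I : choiceType) (F : I -> set_system T).
Hypothesis F_sigma : forall i, sigma_algebra setT (F i).
Hypothesis F_measurable : forall i, F i `<=` measurable.
Hypothesis F_indep : mutually_independent P F.

Notation sigma J := (finite_intersections F J).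

Let sigma_meas J : sigma J `<=` measurable.
Proof. exact: finite_intersections_measurable. Qed.

Lemma measurable_source d1 (T1 : measurableType d1) (X : T -> T1) i J :
  F i = events_of X -> J i ->
  measurable_fun setT (X : g_sigma_algebraType (sigma J) -> T1).
Proof.
move=> FX Ji; apply: measurable_events_of; rewrite -FX.
exact: sub_finite_intersections.
Qed.

Context (M : {RV P >-> nat}) (X : nat -> {RV P >-> R}) (iM : I) (iX : nat -> I).
Hypothesis iX_inj : injective iX.
Hypothesis iX_iM : forall j, iX j != iM.
Hypothesis F_M : F iM = events_of M.
Hypothesis F_X : forall j, F (iX j) = events_of (X j).

Variables (y p s : R).
Hypothesis X_tail : forall j, P [set w | (y < X j w)%R] = p%:E.

Let p_ge0 : (0 <= p)%R.
Proof. by rewrite -lee_fin -(X_tail 0) measure_ge0. Qed.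

Let p_le1 : (p <= 1)%R.
Proof.
by rewrite -lee_fin -(X_tail 0) probability_le1//; exact: measurable_exceeds.
Qed.

Notation r := (thinning_factor p s).

Let r_ge0 : (0 <= r)%R.
Proof. by rewrite thinning_factor_ge0// p_ge0 p_le1. Qed.

Lemma integral_thinned1 j : \int[P]_w (expR (s * (y < X j w)%R%:R))%:E = r%:E.
Proof.
pose A := [set w | (y < X j w)%R].
have mA : measurable A by exact: measurable_exceeds.
transitivity (\int[P]_w ((expR s)%:E * (\1_A w)%:E + (\1_(~` A) w)%:E)).
  apply: eq_integral => w _; rewrite !indicE in_setC.
  rewrite (_ : (w \in A) = (y < X j w)%R); last exact: asboolb.
  case: (y < X j w)%R => /=; first by rewrite mulr1 mule1 adde0.
  by rewrite mulr0 expR0 mule0 add0e.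
rewrite ge0_integralD//; last 2 first.
- by apply: measurable_funeM; exact/measurable_EFinP.
- by apply/measurable_EFinP/measurable_indic; exact: measurableC.
rewrite ge0_integralZl//; last exact/measurable_EFinP.
rewrite !integral_indic//; last exact: measurableC.
rewrite !setIT.
transitivity ((expR s)%:E * P A + P (~` A)) => //.
rewrite probability_setC// [P A]X_tail -EFinM -EFinB -EFinD.
by congr EFin; rewrite /thinning_factor; ring.
Qed.

Lemma integral_thinned_cst m :
  \int[P]_w (expR (s * (\sum_(j < m) (y < X j w)%R)%N%:R))%:E = (r ^+ m)%:E.
Proof.
elim: m => [|m IH].
  under eq_integral do rewrite big_ord0 mulr0 expR0.
  by rewrite integral_cst// mul1e -[RHS](probability_setT P).
under eq_integral do rewrite big_ord_recr/= natrD mulrDr expRD EFinM.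
pose J1 := [set iX l | l in [set l | (l < m)%N]].
pose J2 := [set iX m].
have mJ1 j : (j < m)%N ->
    measurable_fun setT (X j : g_sigma_algebraType (sigma J1) -> R).
  by move=> jm; apply: measurable_source (F_X j) _; exists j.
have mJ2 : measurable_fun setT (X m : g_sigma_algebraType (sigma J2) -> R).
  exact: measurable_source (F_X m) _.
rewrite (@ge0_integral_independentM _ _ _ P (sigma J1) (sigma J2))//.
- by rewrite IH integral_thinned1 -EFinM exprSr.
- apply: independent_groups => //; apply/disj_setPLR.
  by move=> _ [l /= lm <-] /= /iX_inj lE; rewrite lE ltnn in lm.
- apply/measurable_EFinP/measurableT_comp => //; apply: measurable_funM => //.
  under eq_fun do rewrite natr_sum; apply: measurable_sum => j.
  by apply/measurable_bool_natr/measurable_fun_ltr => //; exact: mJ1.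
- apply/measurable_EFinP/measurableT_comp => //; apply: measurable_funM => //.
  exact/measurable_bool_natr/measurable_fun_ltr.
Qed.

(** Freezing the number [M] of customers leaves a product of [M] independent
    factors, each of mean [thinning_factor p s]. *)
Lemma integral_thinned :
  \int[P]_w (expR (s * (\sum_(j < M w) (y < X j w)%R)%N%:R))%:E =
  \int[P]_w (r ^+ M w)%:E.
Proof.
pose J := range iX.
pose G (z : nat * g_sigma_algebraType (sigma J)) : \bar R :=
  (expR (s * (\sum_(j < z.1) (y < X j z.2)%R)%N%:R))%:E.
(* The survival times are averaged with the group size frozen. *)
rewrite -[LHS]/(\int[P]_w G (M w, w)).
rewrite ge0_integral_independent//; last 3 first.
- rewrite -F_M => A B FA sB.
  apply: (independent_groups F_sigma F_measurable F_indep (J1 := [set iM])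
    (J2 := J)) => //.
    by apply/disj_setPRL => _ [l _ <-] /= h; have := iX_iM l; rewrite h eqxx.
  by apply: sub_sigma_algebra; exact: (sub_finite_intersections
    (J := [set iM]) (i := iM) erefl).
- apply/measurable_EFinP.
  apply: (@measurable_thinned_exp _ (nat * g_sigma_algebraType (sigma J))%type R
    s (cst y) fst (fun j z => X j z.2)) => // j.
  have mXj : measurable_fun setT (X j : g_sigma_algebraType (sigma J) -> R).
    by apply: measurable_source (F_X j) _; exists j.
  exact: measurableT_comp.
- by move=> z; rewrite lee_fin expR_ge0.
rewrite /G/=; under eq_integral do rewrite integral_thinned_cst.
rewrite ge0_integral_distribution// => m.
by rewrite lee_fin exprn_ge0.
Qed.

End thinning.

(** * The exponential law *)

Section exponential_law.
Local Open Scope ereal_scope.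
Context d (T : measurableType d) (R : realType) (P : probability T R).
Variables (rate : R) (X : {RV P >-> R}).
Hypothesis rate_gt0 : (0 < rate)%R.
Hypothesis X_exp : same_law (distribution P X) (exponential_prob rate).
Notation leb := (@lebesgue_measure R).

Lemma exponential_lt0 : P [set w | (X w < 0)%R] = 0.
Proof.
transitivity (distribution P X `]-oo, 0%R[).
  by congr (P _); apply/seteqP; split=> w /=; rewrite in_itv.
rewrite X_exp//; apply: integral0_eq => x /=; rewrite in_itv/= => x0.
by rewrite lt0_exponential_pdf.
Qed.

Lemma exponential_tail (y : R) : (0 <= y)%R ->
  P [set w | (y < X w)%R] = (expR (- (rate * y)))%:E.
Proof.
move=> y0.
transitivity (distribution P X `]y, +oo[).
  by congr (P _); apply/seteqP; split=> w /=; rewrite in_itv/= andbT.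
have mpdf := measurable_exponential_pdf rate.
rewrite X_exp// /exponential_prob integral_itv_obnd_cbnd; last first.
  exact/measurable_EFinP/measurable_funTS.
have cexp : continuous (fun z : R^o => expR (- rate * z)).
  move=> z; apply: continuous_comp; last exact: continuous_expR.
  apply: continuousM => //; apply: (@continuousN _ R^o).
  exact: cst_continuous.
rewrite (@ge0_continuous_FTC2y _ _ (fun x => - (expR (- rate * x)))%R _ 0)//.
- by rewrite EFinN oppeK add0e mulNr.
- by move=> x _; apply: exponential_pdf_ge0; exact: ltW.
- apply: (@continuous_subspaceW R^o _ _ [set` `[0%R, +oo[%R]).
    by apply: subset_itvr; rewrite bnd_simp.
  exact: within_continuous_exponential_pdf.
- rewrite -oppr0; apply: cvgN.
  rewrite (_ : (fun x => expR (- rate * x)) =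
               (fun z => expR (- z)) \o (fun z => rate * z))%R; last first.
    by apply: eq_fun => x; rewrite mulNr.
  apply: (@cvg_comp _ _ _ _ _ _ (pinfty_nbhs R)); last exact: cvgr_expR.
  exact: gt0_cvgMry.
- by apply: cvgN; apply/cvg_at_right_filter; exact: cexp.
- move=> x; rewrite in_itv/= andbT => xy; apply: derive1_exponential_pdf.
  by rewrite in_itv/= andbT (le_lt_trans y0).
Qed.

(** The exponential law has the density [exponential_pdf] by definition of its
    values on events; the change of variables is stated for the Radon-Nikodym
    derivative, which equals that density almost everywhere because both have
    the same integral over every event. *)
Lemma integral_exponential (f : R -> \bar R) : measurable_fun setT f ->
  (forall x, 0 <= f x) ->
  \int[distribution P X]_x f x =
  \int[leb]_x (f x * (exponential_pdf rate x)%:E).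
Proof.
move=> mf f0.
(* The Lebesgue measure lives on another copy of the measurable space of real
   numbers, with the same events. *)
have mX' : @measurable_fun _ _ T (measurableTypeR R) setT X.
  by move=> _ A mA; exact: measurable_funP.
pose X' : {RV P >-> measurableTypeR R} :=
  HB.pack (X : T -> measurableTypeR R) (isMeasurableFun.Build _ _ _ _ _ mX').
have mf' : @measurable_fun _ _ (measurableTypeR R) _ setT f.
  by move=> _ A mA; exact: mf.
have X'_exp A : measurable A -> distribution P X' A = exponential_prob rate A.
  by move=> mA; rewrite -X_exp.
transitivity (\int[distribution P X']_x f x).
  by rewrite !ge0_integral_distribution.
have mpdf : measurable_fun [set: measurableTypeR R]
    (EFin \o exponential_pdf rate).
  by apply/measurable_EFinP; exact: measurable_exponential_pdf.
have dom : distribution P X' `<< leb.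
  apply/null_content_dominatesP => A mA A0; rewrite X'_exp//.
  by apply: null_set_integral => //; exact: measurable_funTS.
rewrite -(Radon_Nikodym_SigmaFinite.change_of_variables dom)//.
have mRN : measurable_fun setT
    (Radon_Nikodym_SigmaFinite.f (distribution P X') leb).
  by apply: (measurable_int leb); exact: Radon_Nikodym_SigmaFinite.f_integrable.
apply: ae_eq_integral => //; [exact: emeasurable_funM..|].
apply: ae_eqe_mul2l; apply: integral_ae_eq => //.
  exact: Radon_Nikodym_SigmaFinite.f_integrable.
move=> A _ mA; transitivity (distribution P X' A); last exact: X'_exp.
exact/esym/Radon_Nikodym_SigmaFinite.f_integral.
Qed.

(** The bounds of the integral have two sources: the density vanishes on
    negative numbers, and the indicator beyond [x]. *)
Lemma integral_exponential_itv (x : R) (f : R -> \bar R) :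
  measurable_fun setT (fun a : R => ((a <= x)%R%:R)%:E * f a) ->
  (forall a, 0 <= f a) ->
  \int[distribution P X]_a (((a <= x)%R%:R)%:E * f a) =
  \int[leb]_(a in `[0%R, x]) (f a * (rate * expR (- (rate * a)))%:E).
Proof.
move=> mf f0; rewrite integral_exponential//; last first.
  by move=> a; rewrite mule_ge0// lee_fin.
rewrite [RHS]integral_mkcond; apply: eq_integral => a _.
rewrite patchE mem_setE in_itv/=; have [a0|a0] := leP 0%R a; last first.
  by rewrite lt0_exponential_pdf// mule0.
case: (a <= x)%R => /=; last by rewrite !mul0e.
by rewrite mul1e exponential_pdfE// mulNr.
Qed.

End exponential_law.

(** * The integral equation of the first arrival *)

Section renewal.
Context (R : realType).
Notation leb := (@lebesgue_measure R).

Lemma is_derive1_chain (f g : R -> R) (x df dg : R) :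
  is_derive (g x) 1 f df -> is_derive x 1 g dg ->
  is_derive x 1 (f \o g) (df * dg).
Proof.
move=> fgx gx; have [dfx fE] := fgx; have [dgx gE] := gx.
apply: DeriveDef.
  apply/derivable1_diffP; apply: differentiable_comp; exact/derivable1_diffP.
by rewrite -derive1E derive1_comp// !derive1E fE gE.
Qed.

(** In the integral over the first arrival [a], the exponentials multiply to the
    constant [e^(- nu x)], and what remains is the derivative in [a] of
    [- H (x - a)^(K+1) / (K+1)!], by the fundamental theorem of calculus. *)
Lemma integral_renewal_step (h H : R -> R) (nu x : R) (K : nat) :
  0 <= x -> continuous h -> H 0 = 0 ->
  (forall y : R, 0 <= y -> is_derive y 1 H (nu * h y)) ->
  (\int[leb]_(a in `[0%R, x])
    (h (x - a) * (expR (- (nu * (x - a))) * H (x - a) ^+ K / K`!%:R)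
      * (nu * expR (- (nu * a))))%:E =
   (expR (- (nu * x)) * H x ^+ K.+1 / K.+1`!%:R)%:E)%E.
Proof.
move=> x0 ch H0 dH.
move: x0; rewrite le_eqVlt => /predU1P[<-|x0].
  by rewrite set_itv1 integral_set1 H0 expr0n/= mulr0 mul0r.
pose g a := expR (- (nu * x)) * (nu * h (x - a) * (H (x - a) ^+ K / K`!%:R)).
under eq_integral => a _.
  rewrite (_ : _ * _ * _ = g a); last first.
    rewrite /g (_ : - (nu * x) = - (nu * (x - a)) + - (nu * a)); last by ring.
    by rewrite expRD; ring.
  over.
pose G a := - (expR (- (nu * x)) / K.+1`!%:R) * H (x - a) ^+ K.+1.
have dHx a : a <= x -> is_derive a 1 (fun a => H (x - a)) (- (nu * h (x - a))).
  move=> ax; have dHxa := dH (x - a); rewrite subr_ge0 in dHxa.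
  have {}dHxa := dHxa ax.
  have dsub : is_derive a 1 (fun a : R => x - a) (-1).
    by apply: is_derive_eq; rewrite add0r mul1r.
  have := @is_derive1_chain H (fun a => x - a) a _ _ dHxa dsub.
  by rewrite mulrN1.
have dG a : a <= x -> is_derive a 1 G (g a).
  move=> ax; have dHa := dHx a ax.
  have -> : G = - (expR (- (nu * x)) / K.+1`!%:R) \*:
      ((fun a => H (x - a)) ^+ K.+1).
    by apply/funext => b; rewrite /G exprfctE.
  apply: is_derive_eq.
  rewrite /g /= factS natrM /GRing.scale/=.
  have K0 : (K`!%:R : R) != 0 by rewrite pnatr_eq0 -lt0n fact_gt0.
  have K1 : (K.+1%:R : R) != 0 by rewrite pnatr_eq0.
  move: (K`!%:R : R) (K.+1%:R : R) (H (x - a) ^+ K) K0 K1 => k0 k1 HK K0 K1.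
  by field; rewrite K0 K1.
have contG a : a <= x -> {for a, continuous G}.
  move=> ax; apply: differentiable_continuous.
  by apply/derivable1_diffP; have [] := dG a ax.
rewrite (@continuous_FTC2 _ g G 0 x x0).
- by rewrite -EFinB /G subrr H0 expr0n/= mulr0 subr0 sub0r; congr EFin; ring.
- apply: continuous_in_subspaceT => a; rewrite inE/= in_itv/= => /andP[_ ax].
  have ch' : h (x - b) @[b --> a] --> h (x - a).
    apply: (@continuous_comp _ _ _ (fun a => x - a) h); last exact: ch.
    by apply: (@continuousB _ R^o) => //; exact: cst_continuous.
  have cH' : H (x - b) @[b --> a] --> H (x - a).
    apply: (@differentiable_continuous _ _ _ a (fun a => H (x - a))).
    by apply/derivable1_diffP; have [] := dHx a ax.
suff: g b @[b --> a] --> g a by [].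
  apply: cvgM; first exact: cvg_cst.
  apply: cvgM; first by apply: cvgM; [exact: cvg_cst|exact: ch'].
  by apply: cvgM; [exact: (cvg_comp _ _ cH' (@exprn_continuous _ K _))
    |exact: cvg_cst].
- split.
  + by move=> a /[!in_itv]/= /andP[_ /ltW ax]; have [] := dG a ax.
  + by apply: cvg_at_right_filter; apply: contG; exact: ltW.
  + by apply: cvg_at_left_filter; exact: contG.
- move=> a /[!in_itv]/= /andP[_ /ltW ax]; rewrite derive1E.
  by have dGa := dG a ax; rewrite derive_val.
Qed.

End renewal.

(** * Trajectories with a given number of arrivals *)

Section path_weight.
Context (U : Type) (R : realType).
Context (A : nat -> U -> R) (N : nat -> U -> nat) (S : nat -> nat -> U -> R).
Variable s : R.

Definition batch_weight (m : nat) (y : R) (w : U) : R :=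
  expR (s * (\sum_(j < N m w) (y < S m j w)%R)%N%:R).

(** Numbering batches from [m] and counting time from the arrival of the batch
    [m - 1], the value is [e^s] to the number of customers of these batches
    present at time [x] if exactly [K] of the batches arrived by then, and [0]
    otherwise.  The recursion restarts the clock at the first arrival, which is
    what makes its mean computable; [path_weightE] gives the closed form. *)
Fixpoint path_weight (K m : nat) (x : R) (w : U) : R :=
  if K is K'.+1 then
    (A m w <= x)%R%:R *
      (batch_weight m (x - A m w) w * path_weight K' m.+1 (x - A m w) w)
  else (x < A m w)%R%:R.

Lemma batch_weight_ge0 m y w : 0 <= batch_weight m y w.
Proof. exact: expR_ge0. Qed.

Lemma path_weight_ge0 K m x w : 0 <= path_weight K m x w.
Proof.
elim: K m x => [|K IH] m x /=; first exact: ler0n.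
by rewrite mulr_ge0// mulr_ge0// batch_weight_ge0.
Qed.

Context d (V : measurableType d) (e : V -> U).

(** The map [e] makes the lemma apply both on a sigma-algebra coarser than that
    of [U], with [e] the identity, and on a product with the time variable, with
    [e] a projection. *)
Lemma measurable_batch_weight m (y : V -> R) :
  measurable_fun setT y -> measurable_fun setT (N m \o e) ->
  (forall j, measurable_fun setT (S m j \o e)) ->
  measurable_fun setT (fun v => batch_weight m (y v) (e v)).
Proof.
move=> my mN mS.
exact: (@measurable_thinned_exp _ V R s y (N m \o e) (fun j => S m j \o e)).
Qed.

Lemma measurable_path_weight K m (x : V -> R) :
  (forall i, (m <= i)%N -> measurable_fun setT (A i \o e)) ->
  (forall i, (m <= i)%N -> measurable_fun setT (N i \o e)) ->
  (forall i j, (m <= i)%N -> measurable_fun setT (S i j \o e)) ->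
  measurable_fun setT x ->
  measurable_fun setT (fun v => path_weight K m (x v) (e v)).
Proof.
elim: K m x => [|K IH] m x mA mN mS mx /=.
  by apply: measurable_bool_natr; apply: measurable_fun_ltr => //; exact: mA.
have mxA : measurable_fun setT (fun v => x v - A m (e v)).
  by apply: measurable_funB => //; exact: mA.
apply: measurable_funM.
  by apply: measurable_bool_natr; apply: measurable_fun_ler => //; exact: mA.
apply: measurable_funM.
  by apply: measurable_batch_weight => //; [exact: mN|move=> j; exact: mS].
by apply: IH => // [i mi|i mi|i j mi];
  [exact/mA/ltnW|exact/mN/ltnW|exact/mS/ltnW].
Qed.

End path_weight.

Section expected_path_weight.
Local Open Scope ereal_scope.
Context d (T : measurableType d) (R : realType) (P : probability T R).
Context (nu mu : R) (N : nat -> {RV P >-> nat}) (q : queue_input P).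
Hypothesis nu_gt0 : (0 < nu)%R.
Hypothesis q_queue : batch_arrival_queue nu mu N q.

Notation F := (source_events N q).
Notation sigma J := (finite_intersections F J).

Lemma source_events_sigma i : sigma_algebra setT (F i).
Proof. by case: i => *; exact: sigma_algebra_events_of. Qed.

Lemma source_events_measurable i : F i `<=` measurable.
Proof. by case: i => *; exact: events_of_measurable. Qed.

Let F_indep := sources_independent q_queue.

Definition sources_from (m : nat) : set source :=
  [set i | match i with
           | Interarrival k | BatchSize k | Service k _ => (m <= k)%N
           | _ => False
           end].

Definition sources_of_batch (m : nat) : set source :=
  [set i | match i with
           | BatchSize k | Service k _ => k = m
           | _ => False
           end].

Let sigma_meas J : sigma J `<=` measurable.
Proof.
by apply: finite_intersections_measurable => i _; exact: source_events_measurable.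
Qed.

Lemma measurable_interarrival J i : J (Interarrival i) ->
  measurable_fun setT (interarrival q i : g_sigma_algebraType (sigma J) -> R).
Proof. by move=> Ji; apply: measurable_source Ji. Qed.

Lemma measurable_batch_size J i : J (BatchSize i) ->
  measurable_fun setT (N i : g_sigma_algebraType (sigma J) -> nat).
Proof. by move=> Ji; apply: measurable_source Ji. Qed.

Lemma measurable_service J i j : J (Service i j) ->
  measurable_fun setT (service q i j : g_sigma_algebraType (sigma J) -> R).
Proof. by move=> Ji; apply: measurable_source Ji. Qed.

Variable s : R.
Notation bw := (batch_weight N (service q) s).
Notation pw := (path_weight (interarrival q) N (service q) s).

Variables h H : R -> R.
Hypothesis h_cont : continuous h.
Hypothesis H0 : H 0%R = 0%R.
Hypothesis H_deriv :
  forall y : R, (0 <= y)%R -> is_derive y (1%R : R) H (nu * h y)%R.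
Hypothesis bw_h : forall m y, (0 <= y)%R ->
  \int[P]_w (bw m y w)%:E = (h y)%:E.

(** The batch [m] and what follows it depend on disjoint sets of sources. *)
Lemma integral_batch_path_weight K m y :
  \int[P]_w (bw m y w * pw K m.+1 y w)%:E =
  \int[P]_w (bw m y w)%:E * \int[P]_w (pw K m.+1 y w)%:E.
Proof.
under eq_integral do rewrite EFinM.
apply: (@ge0_integral_independentM _ _ _ P (sigma (sources_of_batch m))
  (sigma (sources_from m.+1))) => //.
- apply: (independent_groups source_events_sigma source_events_measurable
    F_indep); apply/disj_setPLR => -[i|i|i j||i]//= ->; by rewrite ltnn.
- apply/measurable_EFinP.
  apply: (@measurable_batch_weight _ _ _ _ s _
    (g_sigma_algebraType (sigma (sources_of_batch m))) id) => //.
    exact: measurable_batch_size.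
  by move=> j; exact: measurable_service.
- apply/measurable_EFinP.
  apply: (@measurable_path_weight _ _ _ _ _ s _
    (g_sigma_algebraType (sigma (sources_from m.+1))) id) => //.
  + by move=> i mi; exact: measurable_interarrival.
  + by move=> i mi; exact: measurable_batch_size.
  + by move=> i j mi; exact: measurable_service.
- by move=> w; rewrite lee_fin batch_weight_ge0.
- by move=> w; rewrite lee_fin path_weight_ge0.
Qed.

(** By induction on [K], freezing the first interarrival time [a]: the batch
    that arrives then has age [x - a] at time [x], and the process restarts with
    horizon [x - a], independently of that batch. *)
Lemma expected_path_weight K m x : (0 <= x)%R ->
  \int[P]_w (pw K m x w)%:E = (expR (- (nu * x)) * H x ^+ K / K`!%:R)%:E.
Proof.
elim: K m x => [|K IH] m x x0.
  rewrite expr0 mulr1 fact0 divr1 -(exponential_tail nu_gt0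
    (interarrival_exponential q_queue m) x0).
  have mA : measurable [set w | (x < interarrival q m w)%R].
    exact: measurable_exceeds.
  transitivity (\int[P]_w (\1_[set w | (x < interarrival q m w)%R] w)%:E);
    last by rewrite integral_indic// setIT.
  apply: eq_integral => w _; rewrite indicE/=; congr ((_ : bool)%:R)%:E.
  by rewrite [RHS]asboolb.
pose f a := \int[P]_w (bw m (x - a) w * pw K m.+1 (x - a) w)%:E.
pose J := sources_of_batch m `|` sources_from m.+1.
pose G (a : R) (w : T) : \bar R :=
  ((a <= x)%R%:R * (bw m (x - a) w * pw K m.+1 (x - a) w))%:E.
have G0 a w : 0 <= G a w.
  by rewrite lee_fin mulr_ge0// mulr_ge0 ?batch_weight_ge0// path_weight_ge0.
have mG d' (V : measurableType d') (e : V -> T) :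
    (forall i, (m < i)%N -> measurable_fun setT (interarrival q i \o e)) ->
    (forall i, (m <= i)%N -> measurable_fun setT (N i \o e)) ->
    (forall i j, (m <= i)%N -> measurable_fun setT (service q i j \o e)) ->
    measurable_fun setT (fun z : (R * V)%type => G z.1 (e z.2)).
  move=> mA mN mS; apply/measurable_EFinP; apply: measurable_funM.
    exact/measurable_bool_natr/measurable_fun_ler.
  apply: measurable_funM.
    apply: (@measurable_batch_weight _ _ _ _ s _ (R * V)%type (e \o snd)
      m (fun z => x - z.1)%R).
    - exact: measurable_funB.
    - exact: (measurableT_comp (mN _ (leqnn m))).
    - by move=> j; exact: (measurableT_comp (mS _ _ (leqnn m))).
  apply: (@measurable_path_weight _ _ _ _ _ s _ (R * V)%type (e \o snd)
      K m.+1 (fun z => x - z.1)%R).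
  - by move=> i mi; exact: (measurableT_comp (mA _ mi)).
  - by move=> i mi; exact: (measurableT_comp (mN _ (ltnW mi))).
  - by move=> i j mi; exact: (measurableT_comp (mS _ _ (ltnW mi))).
  - exact: measurable_funB.
have intG a : \int[P]_w G a w = ((a <= x)%R%:R)%:E * f a.
  rewrite /G; under eq_integral do rewrite EFinM.
  rewrite ge0_integralZl//.
  - apply/measurable_EFinP; apply: measurable_funM.
      apply: (@measurable_batch_weight _ _ _ _ s _ T id m (cst (x - a))%R) => //.
    exact: (@measurable_path_weight _ _ _ _ _ s _ T id K m.+1 (cst (x - a))%R).
  - by move=> w _; rewrite lee_fin mulr_ge0 ?batch_weight_ge0// path_weight_ge0.
(* The sources after the first arrival are independent of it. *)
rewrite -[LHS]/(\int[P]_w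
  (fun z : R * g_sigma_algebraType (sigma J) => G z.1 z.2)
    (interarrival q m w, w)).
rewrite ge0_integral_independent//; last 2 first.
- move=> B C FB sC.
  apply: (independent_groups source_events_sigma source_events_measurable
    F_indep (J1 := [set Interarrival m]) (J2 := J)) => //.
    apply/disj_setPRL => -[i|i|i j||i] //=; case=> //= mi [im].
    by rewrite im ltnn in mi.
  apply: sub_sigma_algebra.
  exact: (sub_finite_intersections (i := Interarrival m)).
- apply: (mG _ (g_sigma_algebraType (sigma J)) id).
  + by move=> i mi; apply: measurable_interarrival; right.
  + move=> i; rewrite leq_eqVlt => /predU1P[<-|mi]; apply: measurable_batch_size.
      by left.
    by right.
  + move=> i j; rewrite leq_eqVlt => /predU1P[<-|mi]; apply: measurable_service.
      by left.
    by right.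
under eq_integral do rewrite intG.
have f0 a : 0 <= f a.
  apply: integral_ge0 => w _.
  by rewrite lee_fin mulr_ge0 ?batch_weight_ge0// path_weight_ge0.
rewrite (integral_exponential_itv (interarrival_exponential q_queue m))//;
    last first.
  under eq_fun do rewrite -intG.
  apply: (@measurable_fun_fubini_tonelli_F _ _ R T R P (fun z => G z.1 z.2)) => //.
  exact: (mG _ T id).
rewrite -(integral_renewal_step K x0 h_cont H0 H_deriv).
apply: eq_integral => a; rewrite inE/= in_itv/= => /andP[a0 ax].
have xa0 : (0 <= x - a)%R by rewrite subr_ge0.
by rewrite /f integral_batch_path_weight bw_h// IH// -!EFinM.
Qed.

End expected_path_weight.

(** * The number in system along a trajectory *)

Section unrolling.
Context (U : Type) (R : realType).
Context (A : nat -> U -> R) (N : nat -> U -> nat) (S : nat -> nat -> U -> R).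
Variable s : R.

Definition epoch (m i : nat) (w : U) : R := \sum_(k < i.+1) A (m + k)%N w.

Definition survivors (m i : nat) (x : R) (w : U) : nat :=
  (\sum_(j < N (m + i) w) (x < epoch m i w + S (m + i) j w)%R)%N.

Lemma epoch0 m w : epoch m 0 w = A m w.
Proof. by rewrite /epoch big_ord1 addn0. Qed.

Lemma epochS m i w : epoch m i.+1 w = A m w + epoch m.+1 i w.
Proof.
rewrite /epoch big_ord_recl addn0; congr (_ + _); apply: eq_bigr => k _.
by rewrite lift0 addSnnS.
Qed.

Lemma survivorsS m i x w :
  survivors m i.+1 x w = survivors m.+1 i (x - A m w) w.
Proof.
rewrite /survivors epochS addSnnS; apply: eq_bigr => j _.
by rewrite ltrBlDl addrA.
Qed.

Lemma path_weightE K m x w : path_weight A N S s K m x w =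
  if [forall i : 'I_K, epoch m i w <= x] && (x < epoch m K w) then
    expR (s * (\sum_(i < K) survivors m i x w)%N%:R) else 0.
Proof.
elim: K m x => [|K IH] m x /=.
  rewrite epoch0 big_ord0 mulr0 expR0.
  have -> : [forall i : 'I_0, epoch m i w <= x] by apply/forallP => -[].
  by case: (x < A m w).
have -> : [forall i : 'I_K.+1, epoch m i w <= x] =
    (A m w <= x) && [forall i : 'I_K, epoch m.+1 i w <= x - A m w].
  apply/forallP/andP => [h|[h0 /forallP h] i].
    split; first by have := h ord0; rewrite /= epoch0.
    by apply/forallP => i; have := h (lift ord0 i); rewrite /= epochS lerBrDl.
  case: (unliftP ord0 i) => [j ->|->]; last by rewrite /= epoch0.
  by rewrite /= epochS -lerBrDl.
rewrite IH epochS -ltrBlDl -andbA; case: (A m w <= x) => /=; last first.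
  by rewrite mul0r.
rewrite mul1r; case: ifP => _; last by rewrite mulr0.
rewrite big_ord_recl natrD mulrDr expRD; congr (expR (_ * _) * expR (_ * _)).
  congr (_%:R); rewrite /survivors epoch0 addn0.
  by apply: eq_bigr => j _; rewrite ltrBlDl.
by congr (_%:R); apply: eq_bigr => i _; rewrite survivorsS.
Qed.

(** The number of arrivals by time [x] is the first index whose epoch exceeds
    [x], so at most one [K] contributes. *)
Lemma path_weight_first K0 K x w : x < epoch 0 K0 w ->
  (forall i, (i < K0)%N -> epoch 0 i w <= x) ->
  path_weight A N S s K 0 x w =
  if K == K0 then expR (s * (\sum_(i < K0) survivors 0 i x w)%N%:R) else 0.
Proof.
move=> xK0 K0x; rewrite path_weightE.
have [->|KK0] := eqVneq K K0.
  by rewrite xK0 andbT ifT//; apply/forallP => i; exact: K0x.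
case: ifPn => // /andP[/forallP h xK].
have := KK0; rewrite neq_ltn => /orP[KltK0|K0ltK].
  by have := lt_le_trans xK (K0x _ KltK0); rewrite ltxx.
by have := lt_le_trans xK0 (h (Ordinal K0ltK)); rewrite ltxx.
Qed.

Lemma path_weight_never K x w : (forall i, epoch 0 i w <= x) ->
  path_weight A N S s K 0 x w = 0.
Proof.
by move=> h; rewrite path_weightE; case: ifPn => // /andP[_]; rewrite ltNge h.
Qed.

End unrolling.

Section series.
Local Open Scope ereal_scope.
Context (R : realType).

Lemma nneseries_unique (f : nat -> \bar R) n : (forall k, 0 <= f k) ->
  (forall k, k != n -> f k = 0) -> \sum_(0 <= k <oo) f k = f n.
Proof.
move=> f0 fn; rewrite (@nneseriesD1 _ f n)//= eseries0 ?adde0//.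
by move=> k _ /fn.
Qed.

Lemma nneseries_finite_support (f : nat -> \bar R) n : (forall k, 0 <= f k) ->
  (forall k, (n <= k)%N -> f k = 0) ->
  \sum_(0 <= k <oo) f k = \sum_(0 <= k < n) f k.
Proof.
move=> f0 fn; rewrite (@nneseries_split _ f 0 n)// add0n.
rewrite [X in _ + X]eseries0 ?adde0//.
by move=> k nk _; exact: fn.
Qed.

Lemma nneseries_exp (c x : R) :
  \sum_(0 <= k <oo) (c * x ^+ k / k`!%:R)%:E = (c * expR x)%:E.
Proof.
have -> : (fun n => \sum_(0 <= k < n) (c * x ^+ k / k`!%:R)%:E) =
    EFin \o (fun n => c * series (exp_coeff x) n)%R.
  apply/funext => n /=; rewrite /series/= big_distrr/= sumEFin.
  by congr EFin; apply: eq_bigr => k _; rewrite mulrA.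
have cx : series (exp_coeff x) @ \oo --> expR x by exact: is_cvg_series_exp_coeff.
have cc : (c * series (exp_coeff x) n)%R @[n --> \oo] --> (c * expR x)%R.
  by apply: cvgM => //; exact: cvg_cst.
by rewrite EFin_lim; [rewrite (cvg_lim _ cc)|apply/cvg_ex; exists (c * expR x)%R].
Qed.

End series.

Section pathwise.
Context d (T : measurableType d) (R : realType) (P : probability T R).
Context (N : nat -> {RV P >-> nat}) (q : queue_input P).

Lemma first_epoch t w : (exists K, t < arrival_epoch q K w) ->
  exists2 K, t < arrival_epoch q K w &
    forall i, (i < K)%N -> arrival_epoch q i w <= t.
Proof.
move=> ex; case: (ex_minnP ex) => K tK Kmin; exists K => // i iK.
by rewrite leNgt; apply/negP => /Kmin; rewrite leqNgt iK.
Qed.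

Lemma arrival_epoch_homo w : (forall k, 0 <= interarrival q k w) ->
  {homo (fun i => arrival_epoch q i w) : i j / (i <= j)%N >-> i <= j}.
Proof.
move=> A0; apply: homo_leq => [x//|y x z|i]; first exact: le_trans.
by rewrite /arrival_epoch [leRHS]big_ord_recr/= lerDl.
Qed.

(** The epochs increase because the gaps are nonnegative, so that no batch after
    the [K]-th contributes and the series is a finite sum. *)
Lemma number_in_system_first K t w : (forall k, 0 <= interarrival q k w) ->
  t < arrival_epoch q K w ->
  (forall i, (i < K)%N -> arrival_epoch q i w <= t) ->
  number_in_system N q t w = (initial_still_present q t w)%:R +
    (\sum_(i < K) survivors (interarrival q) N (service q) 0 i t w)%N%:R.
Proof.
move=> A0 tK Kt; rewrite /number_in_system.
rewrite (nneseries_finite_support (n := K)).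
- rewrite sumEFin -EFinD/= natr_sum big_mkord; congr (_ + _).
  by apply: eq_bigr => i _; rewrite /batch_still_present Kt.
- by move=> k; rewrite lee_fin.
- move=> k Kk; rewrite /batch_still_present leNgt.
  by rewrite (lt_le_trans tK)//; exact: arrival_epoch_homo.
Qed.

Lemma measurable_arrival_epoch i : measurable_fun setT (arrival_epoch q i).
Proof. exact: measurable_sum. Qed.

Lemma measurable_initial_still_present t :
  measurable_fun setT (fun w => (initial_still_present q t w)%:R : R).
Proof.
exact: (@measurable_thinned_sum _ T R (cst t) (initial_size q)
  (fun j => initial_service q j)).
Qed.

Lemma measurable_number_in_system t :
  measurable_fun setT (number_in_system N q t).
Proof.
apply: measurableT_comp => //; apply: emeasurable_funD.
  by apply/measurable_EFinP; exact: measurable_initial_still_present.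
apply: ge0_emeasurable_sum => [i w _ _|i _]; first by rewrite lee_fin.
apply/measurable_EFinP.
under eq_fun do rewrite /batch_still_present (fun_if (fun k => k%:R)).
apply: measurable_fun_ifT => //.
  by apply: measurable_fun_ler => //; exact: measurable_arrival_epoch.
rewrite (_ : (fun _ => _) = (fun w => (\sum_(j < N i w)
    ((t - arrival_epoch q i w)%R < service q i j w)%R)%N%:R)); last first.
  by apply/funext => w; congr (_%:R); apply: eq_bigr => j _; rewrite ltrBlDl.
apply: (@measurable_thinned_sum _ T R (fun w => t - arrival_epoch q i w) (N i)
  (fun j => service q i j)) => //.
by apply: measurable_funB => //; exact: measurable_arrival_epoch.
Qed.

End pathwise.

(** * The moment generating function of the number in system *)

Section mgf_formula.
Local Open Scope ereal_scope.
Context d (T : measurableType d) (R : realType) (P : probability T R).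
Context (nu mu : R) (N : nat -> {RV P >-> nat}) (q : queue_input P).
Hypothesis nu_gt0 : (0 < nu)%R.
Hypothesis mu_gt0 : (0 < mu)%R.
Hypothesis q_queue : batch_arrival_queue nu mu N q.

Notation F := (source_events N q).
Notation sigma J := (finite_intersections F J).
Notation pw s := (path_weight (interarrival q) N (service q) s).
Notation F_sigma := (@source_events_sigma _ _ _ _ N q).
Notation F_meas := (@source_events_measurable _ _ _ _ N q).
Notation F_indep := (sources_independent q_queue).

Let measurable_pw s K t : measurable_fun setT (pw s K 0 t).
Proof. exact: (@measurable_path_weight _ _ _ _ _ s _ T id K 0 (cst t)). Qed.

Lemma expected_sum_path_weight (s : R) (h H : R -> R) (t : R) :
  continuous h -> H 0%R = 0%R ->
  (forall y : R, (0 <= y)%R -> is_derive y (1%R : R) H (nu * h y)%R) ->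
  (forall m y, (0 <= y)%R ->
    \int[P]_w (batch_weight N (service q) s m y w)%:E = (h y)%:E) ->
  (0 <= t)%R ->
  \int[P]_w (\sum_(0 <= K <oo) (pw s K 0 t w)%:E) =
  (expR (- (nu * t)) * expR (H t))%:E.
Proof.
move=> ch H0 dH bwh t0; rewrite integral_nneseries//; last 2 first.
- by move=> K; exact/measurable_EFinP.
- by move=> K w _; rewrite lee_fin path_weight_ge0.
rewrite -nneseries_exp; apply: eq_eseriesr => K _.
exact: (expected_path_weight nu_gt0 q_queue ch H0 dH bwh).
Qed.

(** At [s = 0] the weights of the trajectories with [K] arrivals are indicators
    of disjoint events, whose probabilities [e^(- nu t) (nu t)^K / K!] add up to
    [1]; their union is the event that finitely many batches arrive by time
    [t]. *)
Lemma ae_nonexplosive (t : R) : (0 <= t)%R ->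
  {ae P, forall w, exists K, (t < arrival_epoch q K w)%R}.
Proof.
move=> t0.
pose D := \bigcup_K [set w | (t < arrival_epoch q K w)%R].
have mD : measurable D.
  apply: bigcupT_measurable => K; apply: measurable_exceeds.
  exact: measurable_arrival_epoch.
have PD : P D = 1.
  have := @expected_sum_path_weight 0 (cst 1%R) (fun y => nu * y)%R t.
  rewrite -expRD addNr expR0 => <- //.
  - transitivity (\int[P]_w (\1_D w)%:E).
      by rewrite integral_indic// setIT.
    apply: eq_integral => w _; rewrite indicE; have [|/negP] := boolP (w \in D).
      rewrite inE => -[K _ tK].
      have [K0 tK0 K0t] := first_epoch (ex_intro _ K tK).
      rewrite (nneseries_unique (n := K0)).
      + by rewrite (path_weight_first _ _ 0 _ tK0 K0t) eqxx mul0r expR0.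
      + by move=> k; rewrite lee_fin path_weight_ge0.
      + by move=> k /negbTE kK0; rewrite (path_weight_first _ _ 0 _ tK0 K0t) kK0.
    rewrite inE => nD; rewrite eseries0// => K _ _.
    rewrite path_weight_never// => i; rewrite leNgt; apply/negP => ti.
    by apply: nD; exists i.
  - exact: cst_continuous.
  - by rewrite mulr0.
  - move=> m y _; under eq_integral do rewrite /batch_weight mul0r expR0.
    by rewrite integral_cst// mul1e -[RHS](probability_setT P).
exists (~` D); split; [exact: measurableC| |].
  by rewrite probability_setC// [P D]PD subee.
by move=> w /= nex [K _ tK]; apply: nex; exists K.
Qed.

Lemma ae_interarrival_ge0 :
  {ae P, forall w, forall k, (0 <= interarrival q k w)%R}.
Proof.
apply/ae_foralln => k; exists [set w | (interarrival q k w < 0)%R]; split.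
- by rewrite -[X in measurable X]setTI; exact: measurable_fun_ltr.
- exact: (exponential_lt0 (interarrival_exponential q_queue k)).
- by move=> w /= /negP; rewrite ltNge.
Qed.

Lemma integral_initial_survivors (s t p : R) :
  (forall k, P [set w | (t < initial_service q k w)%R] = p%:E) ->
  \int[P]_w (expR (s * (initial_still_present q t w)%:R))%:E =
  \int[P]_w (thinning_factor p s ^+ initial_size q w)%:E.
Proof.
move=> tp.
apply: (integral_thinned F_sigma F_meas F_indep
  (M := initial_size q) (X := initial_service q) (iM := InitialSize)
  (iX := InitialService)) => //.
  by move=> i j [].
by move=> j; apply/eqP.
Qed.

Lemma integral_batch_survivors (s : R) m (y : R) : (0 <= y)%R ->
  \int[P]_w (batch_weight N (service q) s m y w)%:E =
  \int[P]_w (thinning_factor (expR (- (mu * y))) s ^+ N m w)%:E.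
Proof.
move=> y0.
apply: (integral_thinned F_sigma F_meas F_indep
  (M := N m) (X := service q m) (iM := BatchSize m)
  (iX := Service m)) => //.
- by move=> i j [].
- by move=> j; apply/eqP.
- by move=> j; apply: exponential_tail => //; exact: (service_exponential q_queue).
Qed.

(** Almost surely, exactly one trajectory weight is nonzero, and it accounts for
    all the batches; the initial customers contribute an independent factor. *)
Lemma mgf_number_in_system (s : R) (h H : R -> R) (t : R) :
  continuous h -> H 0%R = 0%R ->
  (forall y : R, (0 <= y)%R -> is_derive y (1%R : R) H (nu * h y)%R) ->
  (forall m y, (0 <= y)%R ->
    \int[P]_w (thinning_factor (expR (- (mu * y))) s ^+ N m w)%:E = (h y)%:E) ->
  (0 <= t)%R ->
  'M_P (number_in_system N q t) s =
  \int[P]_w (thinning_factor (expR (- (mu * t))) s ^+ initial_size q w)%:E *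
  (expR (- (nu * t)) * expR (H t))%:E.
Proof.
move=> ch H0 dH hE t0.
have bwh m y : (0 <= y)%R ->
    \int[P]_w (batch_weight N (service q) s m y w)%:E = (h y)%:E.
  by move=> y0; rewrite integral_batch_survivors// hE.
pose W w := \sum_(0 <= K <oo) (pw s K 0 t w)%:E.
have mI : measurable_fun setT
    (fun w => expR (s * (initial_still_present q t w)%:R)).
  apply: measurableT_comp => //; apply: measurable_funM => //.
  exact: measurable_initial_still_present.
have mW : measurable_fun setT W.
  apply: ge0_emeasurable_sum => [K w _ _|K _].
    by rewrite lee_fin path_weight_ge0.
  exact/measurable_EFinP.
have W0 w : 0 <= W w.
  by apply: nneseries_ge0 => K _ _; rewrite lee_fin path_weight_ge0.
transitivity (\int[P]_w
    ((expR (s * (initial_still_present q t w)%:R))%:E * W w)).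
  rewrite /mmt_gen_fun unlock; apply: ge0_ae_eq_integral => //.
  - apply/measurable_EFinP; apply: measurableT_comp => //.
    by apply: measurable_funM => //; exact: measurable_number_in_system.
  - by apply: emeasurable_funM => //; exact/measurable_EFinP.
  - by move=> w _; rewrite lee_fin expR_ge0.
  - by move=> w _; rewrite mule_ge0// lee_fin expR_ge0.
  have := ae_interarrival_ge0; apply: filterS2 (ae_nonexplosive t0) => w ex A0 _.
  have [K tK Kt] := first_epoch ex.
  rewrite /= (number_in_system_first _ A0 tK Kt) /W.
  rewrite (nneseries_unique (n := K)).
  - rewrite (path_weight_first _ _ s _ tK Kt) eqxx -EFinM -expRD -mulrDr.
    by rewrite mulrC.
  - by move=> k; rewrite lee_fin path_weight_ge0.
  - by move=> k /negbTE kK; rewrite (path_weight_first _ _ s _ tK Kt) kK.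
pose J1 : set source := [set i | match i with
  | InitialSize | InitialService _ => True | _ => False end].
rewrite (@ge0_integral_independentM _ _ _ P (sigma J1) (sigma (sources_from 0))).
- rewrite (integral_initial_survivors s (p := expR (- (mu * t)))).
    by rewrite -(expected_sum_path_weight ch H0 dH bwh t0).
  move=> k; apply: exponential_tail => //.
  exact: (initial_service_exponential q_queue).
- by apply: finite_intersections_measurable => i _; exact: F_meas.
- by apply: finite_intersections_measurable => i _; exact: F_meas.
- apply: (independent_groups F_sigma F_meas F_indep).
  by apply/disj_setPLR => -[i|i|i j||i] //= _ [].
- apply/measurable_EFinP.
  apply: (@measurable_thinned_exp _ (g_sigma_algebraType (sigma J1)) R s
    (cst t) (initial_size q) (fun j => initial_service q j)) => //.
    by apply: (measurable_source (i := InitialSize)).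
  by move=> j; apply: (measurable_source (i := InitialService j)).
- apply: ge0_emeasurable_sum => [K w _ _|K _].
    by rewrite lee_fin path_weight_ge0.
  apply/measurable_EFinP.
  apply: (@measurable_path_weight _ _ _ _ _ s _
    (g_sigma_algebraType (sigma (sources_from 0))) id K 0 (cst t)) => //.
  + by move=> i mi; exact: measurable_interarrival.
  + by move=> i mi; exact: measurable_batch_size.
  + by move=> i j mi; exact: measurable_service.
- by move=> w; rewrite lee_fin expR_ge0.
- exact: W0.
Qed.

(** At time [0] the residual services and the first interarrival time are almost
    surely positive, so that the number in system is the initial size. *)
Lemma mgf_number_in_system0 s :
  'M_P (number_in_system N q 0%R) s = \int[P]_w ((expR s) ^+ initial_size q w)%:E.
Proof.
have p1 : forall k, P [set w | (0 < initial_service q k w)%R] = 1%:E.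
  move=> k.
  by rewrite (exponential_tail mu_gt0 (initial_service_exponential q_queue k)) //
    mulr0 oppr0 expR0.
transitivity (\int[P]_w (expR (s * (initial_still_present q 0%R w)%:R))%:E);
  last first.
  rewrite (integral_initial_survivors s p1); apply: eq_integral => w _.
  by rewrite /thinning_factor mul1r addrC subrK.
rewrite /mmt_gen_fun unlock; apply: ge0_ae_eq_integral => //.
- apply/measurable_EFinP; apply: measurableT_comp => //.
  by apply: measurable_funM => //; exact: measurable_number_in_system.
- apply/measurable_EFinP; apply: measurableT_comp => //.
  by apply: measurable_funM => //; exact: measurable_initial_still_present.
- by move=> w _; rewrite lee_fin expR_ge0.
have A0gt0 : {ae P, forall w, (0 < interarrival q 0 w)%R}.
  have mA : measurable [set w | (0 < interarrival q 0 w)%R].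
    exact: measurable_exceeds.
  exists (~` [set w | (0 < interarrival q 0 w)%R]); split => //.
    exact: measurableC.
  rewrite probability_setC//.
  rewrite [P _](exponential_tail nu_gt0 (interarrival_exponential q_queue 0))//.
  by rewrite mulr0 oppr0 expR0 subee.
have := ae_interarrival_ge0; apply: filterS2 A0gt0 => w Agt0 A0 _.
rewrite /= (number_in_system_first (K := 0) _ A0)//; last first.
  by rewrite /arrival_epoch big_ord1.
by rewrite big_ord0 addr0 mulrC.
Qed.

End mgf_formula.

(** * Limits of the thinning factor *)

Section thinning_factor_limits.
Context (R : realType).
Implicit Types (p s theta : R) (k n m : nat).

Lemma expRB1_le (v : R) : expR v - 1 <= v * expR v.
Proof.
have := expR_ge1Dx (- v); rewrite -(ler_pM2r (expR_gt0 v)) -expRD addNr expR0.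
by rewrite mulrDl mul1r mulNr lerBlDr lerBlDl.
Qed.

(** This bound, uniform in [n >= 2m] and [p], feeds the dominated convergences.  For
    [theta >= 0] and [x = k theta], it comes from
    [n (e^(x/n) - 1) <= x e^(x/n) <= x e^(x/2m) <= 2m e^(x/m)]: replacing [m] by
    [2m] leaves room to absorb the factor [x] into the exponential.  For
    [theta < 0] the first term alone bounds, since [1 - e^v <= - v]. *)
Lemma thinning_factorX_dominated p theta k n m : 0 <= p <= 1 -> (0 < m)%N ->
  (2 * m <= n)%N ->
  `|n%:R * (thinning_factor p (theta / n%:R) ^+ k - 1)| <=
  `|theta| * k%:R + 2 * m%:R * expR (k%:R * (theta / m%:R)).
Proof.
move=> p01 m0 mn.
have n0 : (0 < n)%N by rewrite (leq_trans _ mn)// muln_gt0.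
have nR0 : 0 < n%:R :> R by rewrite ltr0n.
have mR0 : 0 < m%:R :> R by rewrite ltr0n.
rewrite normrM ger0_norm ?ler0n//.
have [th0|th0] := leP 0 theta.
  have v0 : 0 <= theta / n%:R by rewrite divr_ge0.
  have /andP[r1 rs] := thinning_factor_le p01 v0.
  rewrite ger0_norm ?subr_ge0 ?exprn_ege1//.
  set x : R := k%:R * theta; have x0 : 0 <= x by rewrite mulr_ge0.
  apply: (@le_trans _ _ (n%:R * (expR (x / n%:R) - 1))).
    rewrite ler_wpM2l// lerB// /x -mulrA expRM_natl.
    by rewrite lerXn2r ?nnegrE ?expR_ge0 ?thinning_factor_ge0.
  apply: (@le_trans _ _ (x * expR (x / n%:R))).
    have := expRB1_le (x / n%:R); rewrite -(ler_pM2l nR0) => /le_trans; apply.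
    by rewrite mulrA mulrCA divff ?gt_eqF// mulr1.
  apply: (@le_trans _ _ (x * expR (x / (2 * m%:R)))).
    rewrite ler_wpM2l// ler_expR ler_wpM2l// lef_pV2 ?posrE ?mulr_gt0//.
    by rewrite -natrM ler_nat.
  apply: (@le_trans _ _ (2 * m%:R * expR (x / m%:R))); last first.
    by rewrite /x mulrA lerDr mulr_ge0.
  have -> : x / m%:R = x / (2 * m%:R) + x / (2 * m%:R).
    by field; rewrite gt_eqF.
  rewrite expRD mulrA ler_wpM2r ?expR_ge0//.
  rewrite -ler_pdivrMl ?mulr_gt0// mulrC.
  by rewrite (le_trans _ (expR_ge1Dx _))// lerDr.
have v0 : theta / n%:R <= 0 by rewrite pmulr_lle0 ?invr_gt0// ltW.
have /andP[r1 rs] := thinning_factor_ge p01 v0.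
rewrite ler0_norm ?subr_le0 ?exprn_ile1 ?thinning_factor_ge0// opprB.
rewrite (ler0_norm (ltW th0)).
apply: (@le_trans _ _ (- theta * k%:R)); last first.
  by rewrite lerDl !mulr_ge0 ?expR_ge0.
rewrite -ler_pdivlMl// lerBlDl.
apply: (@le_trans _ _ (expR (k%:R * (theta / n%:R)) +
    n%:R^-1 * (- theta * k%:R))).
  by rewrite -lerBlDr (le_trans _ (expR_ge1Dx _))// lerD2l; lra.
rewrite lerD2r expRM_natl lerXn2r ?nnegrE ?expR_ge0//.
exact: thinning_factor_ge0.
Qed.

Lemma cvg_div_nat theta : theta / n%:R @[n --> \oo] --> (0 : R).
Proof.
rewrite -[X in _ --> X](mulr0 theta); apply: cvgM; first exact: cvg_cst.
by rewrite -cvg_shiftS; exact: cvg_harmonic.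
Qed.

Lemma cvg_exp_div_nat theta : expR (theta / n%:R) @[n --> \oo] --> (1 : R).
Proof.
rewrite -[X in _ --> X]expR0.
exact: (cvg_comp _ _ (cvg_div_nat theta) (@continuous_expR R 0)).
Qed.

(** The sequence lies between [theta] and [theta * expR (theta / n)]. *)
Lemma cvg_natM_expRB1 theta :
  n%:R * (expR (theta / n%:R) - 1) @[n --> \oo] --> theta.
Proof.
apply: (@squeeze_cvgr _ _ _ _ (cst theta) (fun n => theta * expR (theta / n%:R))).
- near=> n; have n0 : 0 < n%:R :> R by rewrite ltr0n; near: n; exact: nbhs_infty_gt.
  rewrite /= -ler_pdivrMl// mulrC lerBrDl expR_ge1Dx/=.
  rewrite -ler_pdivlMl// mulrA (mulrC n%:R^-1); exact: expRB1_le.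
- exact: cvg_cst.
- rewrite -[X in _ --> X]mulr1; apply: cvgM; first exact: cvg_cst.
  exact: cvg_exp_div_nat.
Unshelve. all: by end_near. Qed.

Lemma cvg_thinning_factor p theta :
  thinning_factor p (theta / n%:R) @[n --> \oo] --> (1 : R).
Proof.
have : 1 + p * (expR (theta / n%:R) - 1) @[n --> \oo] --> 1 + p * (1 - 1).
  apply: cvgD; first exact: cvg_cst.
  apply: cvgM; first exact: cvg_cst.
  by apply: cvgB; [exact: cvg_exp_div_nat|exact: cvg_cst].
by rewrite subrr mulr0 addr0.
Qed.

(** By induction on [k], from
    [n (r^(k+1) - 1) = r * (n (r^k - 1)) + n (r - 1)] with [r] tending to
    [1]. *)
Lemma cvg_natM_thinning_factorX p theta k :
  n%:R * (thinning_factor p (theta / n%:R) ^+ k - 1) @[n --> \oo] -->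
  p * theta * k%:R.
Proof.
elim: k => [|k IH].
  rewrite mulr0; under eq_fun do rewrite expr0 subrr mulr0.
  exact: cvg_cst.
have -> : (fun n => n%:R * (thinning_factor p (theta / n%:R) ^+ k.+1 - 1)) =
    (fun n => thinning_factor p (theta / n%:R) *
      (n%:R * (thinning_factor p (theta / n%:R) ^+ k - 1)) +
      p * (n%:R * (expR (theta / n%:R) - 1))).
  apply/funext => n; rewrite exprS.
  by rewrite /thinning_factor; ring.
rewrite -natr1 mulrDr mulr1 -[X in X + _]mul1r; apply: cvgD.
  by apply: cvgM => //; exact: cvg_thinning_factor.
by apply: cvgM; [exact: cvg_cst|exact: cvg_natM_expRB1].
Qed.

End thinning_factor_limits.

(** * Integrals of limits and antiderivatives *)

Section dominated.
Context d (T : measurableType d) (R : realType).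
Context (mu : {measure set T -> \bar R}).

Lemma cvg_Rintegral_dominated (D : set T) (f : nat -> T -> R) (l g : T -> R)
    (n0 : nat) : measurable D ->
  (forall n, (n0 <= n)%N -> measurable_fun D (f n)) ->
  (forall x, D x -> f n x @[n --> \oo] --> l x) ->
  mu.-integrable D (EFin \o g) ->
  (forall n x, (n0 <= n)%N -> D x -> `|f n x| <= g x) ->
  \int[mu]_(x in D) f n x @[n --> \oo] --> \int[mu]_(x in D) l x.
Proof.
move=> mD mf fl ig fg; rewrite -(cvg_shiftn n0) /=.
have fl' x : D x -> (f (n + n0)%N x)%:E @[n --> \oo] --> (l x)%:E.
  move=> Dx; apply: cvg_EFin; first exact: nearW.
  by have := fl x Dx; rewrite -(cvg_shiftn n0).
have ml : measurable_fun D (EFin \o l).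
  apply: (emeasurable_fun_cvg (fun n x => (f (n + n0)%N x)%:E)) => // n.
  by apply/measurable_EFinP; apply: mf; exact: leq_addl.
have [|||||il _ cvgl] := @dominated_convergence _ T R mu D mD
  (fun n x => (f (n + n0)%N x)%:E) (EFin \o l) (EFin \o g).
- by move=> n; apply/measurable_EFinP; apply: mf; exact: leq_addl.
- by [].
- by apply: aeW => x Dx; exact: fl'.
- by [].
- by apply: aeW => x n Dx; rewrite lee_fin; apply: fg => //; exact: leq_addl.
apply: fine_cvg; rewrite /Rintegral fineK//.
exact: integrable_fin_num il.
Qed.

End dominated.

Section antiderivative.
Context (R : realType).
Notation leb := (@lebesgue_measure R).

Lemma integrable_itv (h : R -> R) (a b : R) : continuous h ->
  leb.-integrable `[a, b] (EFin \o h).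
Proof.
move=> ch; apply: continuous_compact_integrable; first exact: segment_compact.
exact: continuous_subspaceT.
Qed.

(** The integral is started at [-1], so that [0] is an interior point and the
    derivative at [0] is two-sided. *)
Lemma ex_antiderivative (h : R -> R) : continuous h ->
  exists H : R -> R, [/\ H 0 = 0,
    forall y : R, 0 <= y -> is_derive y (1 : R) H (h y) &
    forall t, 0 <= t -> H t = \int[leb]_(y in `[0, t]) h y].
Proof.
move=> ch; pose G (y : R) := \int[leb]_(x in `[-1, y]) h x.
pose H y := G y - G 0.
have dH (y : R) : 0 <= y -> is_derive y (1 : R) H (h y).
  move=> y0; have yy1 : y < y + 1 by rewrite ltrDl.
  have y1 : -1 < y by rewrite (lt_le_trans _ y0)// ltrN10.
  have [dG GE] := continuous_FTC1_closed yy1 (@integrable_itv h _ _ ch) y1 (ch y).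
  have dGy : is_derive y (1 : R) G (h y) by apply: DeriveDef => //; rewrite -derive1E.
  have -> : H = G - cst (G 0) by apply/funext.
  by apply: is_derive_eq; rewrite subr0.
exists H; split; [by rewrite /H subrr|by []|].
move=> t; rewrite le_eqVlt => /predU1P[<-|t0].
  by rewrite /H subrr set_itv1 Rintegral_set1.
have cH (y : R) : 0 <= y -> {for y, continuous H}.
  move=> y0; apply: differentiable_continuous; apply/derivable1_diffP.
  by have [] := dH y y0.
rewrite /Rintegral (@continuous_FTC2 _ h H 0 t t0)/=.
- by rewrite /H subrr subr0.
- exact: continuous_subspaceT.
- split.
  + by move=> y /[!in_itv]/= /andP[/ltW y0 _]; have [] := dH y y0.
  + by apply: cvg_at_right_filter; exact: cH.
  + by apply: cvg_at_left_filter; apply: cH; exact: ltW.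
- move=> y /[!in_itv]/= /andP[/ltW y0 _]; rewrite derive1E.
  by have dHy := dH y y0; rewrite derive_val.
Qed.

Lemma Rintegral_expRN (mu t : R) : 0 < mu -> 0 <= t ->
  \int[leb]_(y in `[0, t]) expR (- (mu * y)) = (1 - expR (- (mu * t))) / mu.
Proof.
move=> mu0; rewrite le_eqVlt => /predU1P[<-|t0].
  by rewrite set_itv1 Rintegral_set1 mulr0 oppr0 expR0 subrr mul0r.
pose H (y : R) := - mu^-1 * expR (- (mu * y)).
have dlin (y : R) : is_derive y (1 : R) (fun y => - (mu * y)) (- mu).
  have -> : (fun y => - (mu * y)) = (- mu) \*: id.
    by apply/funext => z; rewrite /= /GRing.scale/= mulNr.
  by apply: is_derive_eq; rewrite /GRing.scale/= mulr1.
have dexp (y : R) : is_derive y (1 : R) (fun y => expR (- (mu * y)))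
    (expR (- (mu * y)) * - mu).
  exact: (@is_derive1_chain _ expR (fun y => - (mu * y)) y).
have dH (y : R) : is_derive y (1 : R) H (expR (- (mu * y))).
  have dexpy := dexp y.
  have -> : H = (- mu^-1) \*: (fun y => expR (- (mu * y))) by apply/funext.
  apply: is_derive_eq; rewrite /GRing.scale/= mulrN mulNr mulrN opprK.
  by rewrite mulrCA mulVf ?gt_eqF// mulr1.
have cexp : continuous (fun y => expR (- (mu * y))).
  move=> y; apply: differentiable_continuous; apply/derivable1_diffP.
  by have [] := dexp y.
have cH : continuous H.
  move=> y; apply: differentiable_continuous; apply/derivable1_diffP.
  by have [] := dH y.
rewrite /Rintegral (@continuous_FTC2 _ _ H 0 t t0)/=.
- by rewrite /H mulr0 oppr0 expR0; ring.
- exact: continuous_subspaceT.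
- split.
  + by move=> y _; have [] := dH y.
  + by apply: cvg_at_right_filter; exact: cH.
  + by apply: cvg_at_left_filter; exact: cH.
- move=> y _; rewrite derive1E.
  by have dHy := dH y; rewrite derive_val.
Qed.

End antiderivative.

(** * The contribution of the batches in the limit *)

Section power_of_count.
Context d (T : measurableType d) (R : realType) (P : probability T R).
Context (M : {RV P >-> nat}).

Lemma measurable_powM (r : R) : measurable_fun setT (fun w => r ^+ M w).
Proof. exact: (measurableT_comp (f := fun k => r ^+ k)). Qed.

Variables (mu theta : R) (m : nat).
Hypothesis mu_gt0 : 0 < mu.
Hypothesis m_gt0 : (0 < m)%N.
Hypothesis M_integrable : P.-integrable setT (fun w => ((M w)%:R : R)%:E).
Hypothesis M_mgf : P.-integrable setT
  (fun w => (expR ((M w)%:R * (theta / m%:R)))%:E).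

Notation leb := (@lebesgue_measure R).
Notation presence y := (expR (- (mu * `|y|))).

Let dominator (w : T) : R :=
  `|theta| * (M w)%:R + 2 * m%:R * expR ((M w)%:R * (theta / m%:R)).

Let dominator_integrable : P.-integrable setT (EFin \o dominator).
Proof.
rewrite (_ : _ \o _ = ((fun w => `|theta|%:E * ((M w)%:R : R)%:E) \+
  (fun w => (2 * m%:R)%:E * (expR ((M w)%:R * (theta / m%:R)))%:E))%E).
  by apply: integrableD => //; exact: integrableZl.
by apply/funext => w /=; rewrite EFinD !EFinM.
Qed.

Lemma presence_itv (y : R) : 0 <= presence y <= 1.
Proof. by rewrite expRN_itv01// mulr_ge0// ltW. Qed.

(** The contribution at scale [n] of a batch of age [y].  The absolute value in
    the presence probability makes it continuous and bounded on the whole line,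
    beyond the ages [y >= 0] that matter. *)
Definition batch_pgf (n : nat) (y : R) : R :=
  \int[P]_w (thinning_factor (presence y) (theta / n%:R) ^+ M w).

Section fixed_scale.
Variable n : nat.
Hypothesis mn : (2 * m <= n)%N.

Let n_gt0 : 0 < n%:R :> R.
Proof. by rewrite ltr0n (leq_trans _ mn)// muln_gt0. Qed.

Let dominated (y : R) w :
  `|n%:R * (thinning_factor (presence y) (theta / n%:R) ^+ M w - 1)| <=
  dominator w.
Proof. exact: thinning_factorX_dominated (presence_itv y) m_gt0 mn. Qed.

Let dominated' (y : R) w :
  `|thinning_factor (presence y) (theta / n%:R) ^+ M w| <= 1 + dominator w.
Proof.
have := dominated y w; set r := _ ^+ _ => rd.
rewrite -lerBlDl; apply: le_trans rd.
have n1 : 1 <= n%:R :> R by rewrite ler1n -(ltr0n R).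
rewrite normrM ger0_norm ?ler0n//.
have := lerB_dist r 1; rewrite normr1 => /le_trans; apply.
by rewrite ler_peMl.
Qed.

Let integrable_dominator1 :
  P.-integrable setT (EFin \o (fun w => 1 + dominator w)).
Proof.
rewrite (_ : _ \o _ = ((fun=> 1%:E) \+ (fun w => (dominator w)%:E))%E)//.
by apply: integrableD => //; exact: (finite_measure_integrable_cst P 1).
Qed.

Lemma integrable_batch_pgf (y : R) : P.-integrable setT
  (EFin \o (fun w => thinning_factor (presence y) (theta / n%:R) ^+ M w)).
Proof.
apply: (@le_integrable _ _ _ _ _ _ _ (EFin \o (fun w => 1 + dominator w))) => //.
  exact/measurable_EFinP/measurable_powM.
move=> w _; rewrite lee_fin; apply: le_trans (dominated' y w) _.
exact: ler_norm.
Qed.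

Lemma batch_pgfE (y : R) : (\int[P]_w
  (thinning_factor (presence y) (theta / n%:R) ^+ M w)%:E = (batch_pgf n y)%:E)%E.
Proof.
by rewrite fineK//; apply: integrable_fin_num (integrable_batch_pgf y).
Qed.

Lemma continuous_batch_pgf : continuous (batch_pgf n).
Proof.
move=> x.
have Ix : x \in (`]x - 1, x + 1[%classic : set R).
  by rewrite inE/= in_itv/= ltrDl ltrBlDr ltrDl ltr01.
apply: (@continuity_under_integral R _ T P
  (fun y w => thinning_factor (presence y) (theta / n%:R) ^+ M w) setT
  measurableT (x - 1) (x + 1) _ _ (fun w => 1 + dominator w) _ _ x Ix) => //.
- by move=> y _; exact: integrable_batch_pgf.
- apply: aeW => w _ y _.
  apply: (@continuous_comp _ _ _
    (fun y => thinning_factor (presence y) (theta / n%:R)) (fun r => r ^+ M w)).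
    apply: cvgD; first exact: cvg_cst.
    apply: cvgM; last exact: cvg_cst.
    apply: (@continuous_comp _ _ _ (fun y => - (mu * `|y|)) expR).
      by apply: cvgN; apply: cvgM; [exact: cvg_cst|exact: norm_continuous].
    exact: continuous_expR.
  exact: exprn_continuous.
- by move=> y _; apply: aeW => w _.
Qed.

Lemma batch_pgf_centered (y : R) : n%:R * (batch_pgf n y - 1) =
  \int[P]_w (n%:R * (thinning_factor (presence y) (theta / n%:R) ^+ M w - 1)).
Proof.
have i1 : P.-integrable setT (EFin \o cst (1 : R)).
  exact: finite_measure_integrable_cst.
have ipgf := integrable_batch_pgf y.
rewrite RintegralZl//; last first.
  rewrite (_ : _ \o _ = ((fun w => (thinning_factor (presence y)
    (theta / n%:R) ^+ M w)%:E) \- (fun=> 1%:E))%E)//.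
  exact: integrableB.
rewrite RintegralB// Rintegral_cst//.
by rewrite [X in fine X](_ : _ = 1%E) ?mulr1//; exact: probability_setT.
Qed.

Lemma batch_pgf_centered_le y :
  `|n%:R * (batch_pgf n y - 1)| <= \int[P]_w dominator w.
Proof.
rewrite batch_pgf_centered.
have mf : measurable_fun setT
    (fun w => n%:R * (thinning_factor (presence y) (theta / n%:R) ^+ M w - 1)).
  apply: measurable_funM => //; apply: measurable_funB => //.
  exact: measurable_powM.
have ifn : P.-integrable setT (EFin \o
    (fun w => n%:R * (thinning_factor (presence y) (theta / n%:R) ^+ M w - 1))).
  apply: (@le_integrable _ _ _ _ _ _ _ (EFin \o dominator)) => //.
    exact/measurable_EFinP.
  by move=> w _; rewrite lee_fin (le_trans (dominated y w))// ler_norm.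
apply: le_trans (le_normr_Rintegral _ ifn) _ => //.
apply: fine_le.
- by apply: integrable_fin_num => //; exact: integrable_norm ifn.
- exact: integrable_fin_num.
- apply: ge0_le_integral => //.
  + by apply/measurable_EFinP; exact: measurableT_comp.
  + exact: measurable_int dominator_integrable.
  + by move=> w _; rewrite lee_fin dominated.
Qed.

End fixed_scale.

Lemma cvg_batch_pgf_centered (y : R) :
  n%:R * (batch_pgf n y - 1) @[n --> \oo] -->
  presence y * theta * \int[P]_w (M w)%:R.
Proof.
have -> : presence y * theta * \int[P]_w (M w)%:R =
    \int[P]_w (presence y * theta * (M w)%:R) by rewrite RintegralZl.
have : \int[P]_w (n%:R *
      (thinning_factor (presence y) (theta / n%:R) ^+ M w - 1)) @[n --> \oo] -->
    \int[P]_w (presence y * theta * (M w)%:R).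
  apply: (cvg_Rintegral_dominated (n0 := (2 * m)%N) (g := dominator)) => //.
  - move=> n mn; apply: measurable_funM => //; apply: measurable_funB => //.
    exact: measurable_powM.
  - by move=> w _; exact: cvg_natM_thinning_factorX.
  - by move=> n w mn _; exact: thinning_factorX_dominated (presence_itv y) m_gt0 mn.
apply: cvg_trans; apply: near_eq_cvg; near=> n.
rewrite batch_pgf_centered//; near: n; exact: nbhs_infty_ge.
Unshelve. all: by end_near. Qed.

Lemma cvg_Rintegral_batch_pgf t : 0 <= t ->
  n%:R * (\int[leb]_(y in `[0, t]) batch_pgf n y - t) @[n --> \oo] -->
  \int[P]_w (M w)%:R * theta / mu * (1 - expR (- (mu * t))).
Proof.
move=> t0.
have lebt : fine (leb `[0, t]) = t.
  rewrite lebesgue_measure_itv/= lte_fin; move: t0.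
  by rewrite le_eqVlt => /predU1P[<-|->]; rewrite ?ltxx// -EFinB/= subr0.
have bounded_int : leb.-integrable `[0, t]
    (EFin \o cst (\int[P]_w dominator w : R)).
  by apply: integrable_itv; exact: cst_continuous.
have -> : \int[P]_w (M w)%:R * theta / mu * (1 - expR (- (mu * t))) =
    \int[leb]_(y in `[0, t]) (presence y * theta * \int[P]_w (M w)%:R).
  rewrite (_ : \int[leb]_(y in `[0, t]) _ = \int[leb]_(y in `[0, t])
      ((theta * \int[P]_w (M w)%:R) * expR (- (mu * y)))); last first.
    apply: eq_Rintegral => y; rewrite inE/= in_itv/= => /andP[y0 _].
    by rewrite ger0_norm//; ring.
  rewrite RintegralZl//; last first.
    apply: integrable_itv => y.
    apply: (@continuous_comp _ _ _ (fun y => - (mu * y)) expR).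
      by apply: cvgN; apply: cvgM => //; exact: cvg_cst.
    exact: continuous_expR.
  by rewrite Rintegral_expRN//; ring.
have : \int[leb]_(y in `[0, t]) (n%:R * (batch_pgf n y - 1)) @[n --> \oo] -->
    \int[leb]_(y in `[0, t]) (presence y * theta * \int[P]_w (M w)%:R).
  apply: (cvg_Rintegral_dominated (n0 := (2 * m)%N)
    (g := cst (\int[P]_w dominator w))) => //.
  - move=> n mn; apply: measurable_funTS; apply: measurable_funM => //.
    apply: measurable_funB => //.
    by apply: continuous_measurable_fun; exact: continuous_batch_pgf.
  - by move=> y _; exact: cvg_batch_pgf_centered.
  - by move=> n y mn _; exact: batch_pgf_centered_le.
apply: cvg_trans; apply: near_eq_cvg; near=> n.
have mn : (2 * m <= n)%N by near: n; exact: nbhs_infty_ge.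
have ih : leb.-integrable `[0, t] (EFin \o batch_pgf n).
  by apply: integrable_itv; exact: continuous_batch_pgf.
have i1 : leb.-integrable `[0, t] (EFin \o cst (1 : R)).
  by apply: integrable_itv; exact: cst_continuous.
rewrite RintegralZl//; last first.
  rewrite (_ : _ \o _ =
    ((fun y => (batch_pgf n y)%:E) \- (fun=> 1%:E))%E)//.
  exact: integrableB.
by rewrite RintegralB// Rintegral_cst// mul1r lebt.
Unshelve. all: by end_near. Qed.

End power_of_count.

(** * The contribution of the initial customers in the limit *)

Section initial_customers.
Context d (T : measurableType d) (R : realType) (P : probability T R).

Lemma integral_powM_same_law (M M' : {RV P >-> nat}) (r : R) : 0 <= r ->
  same_law (distribution P M) (distribution P M') ->
  (\int[P]_w (r ^+ M w)%:E = \int[P]_w (r ^+ M' w)%:E)%E.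
Proof.
move=> r0 MM'.
have r0k k : (0 <= (r ^+ k)%:E)%E by rewrite lee_fin exprn_ge0.
rewrite -(ge0_integral_distribution M (f := fun k => (r ^+ k)%:E))//.
rewrite -(ge0_integral_distribution M' (f := fun k => (r ^+ k)%:E))//.
by apply: eq_measure_integral => A mA _; exact: MM'.
Qed.

Lemma le_integral_powM (M : {RV P >-> nat}) (r r' : R) : 0 <= r <= r' ->
  (\int[P]_w (r ^+ M w)%:E <= \int[P]_w (r' ^+ M w)%:E)%E.
Proof.
move=> /andP[r0 rr']; have r'0 := le_trans r0 rr'.
apply: ge0_le_integral => //.
- by move=> w _; rewrite lee_fin exprn_ge0.
- exact/measurable_EFinP/measurable_powM.
- exact/measurable_EFinP/measurable_powM.
- by move=> w _; rewrite lee_fin lerXn2r ?nnegrE.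
Qed.

Lemma cvg_natM_thinning_factor (p theta : R) :
  n%:R * (thinning_factor p (theta / n%:R) - 1) @[n --> \oo] --> p * theta.
Proof.
by have := @cvg_natM_thinning_factorX R p theta 1; rewrite mulr1.
Qed.

(** With [r] the thinning factor, [e^(1 - 1/r) <= r <= e^(r - 1)], where
    [n (r - 1)] and [n (1 - 1/r)] both tend to [p theta]. *)
Lemma thinning_factor_squeeze (p theta e : R) : 0 <= p <= 1 -> 0 < e ->
  \forall n \near \oo,
    expR ((p * theta - e) / n%:R) <= thinning_factor p (theta / n%:R) <=
    expR ((p * theta + e) / n%:R).
Proof.
move=> p01 e0.
have rcvg := @cvg_natM_thinning_factor p theta.
have rcvg' : n%:R * (thinning_factor p (theta / n%:R) - 1) /
    thinning_factor p (theta / n%:R) @[n --> \oo] --> p * theta.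
  rewrite -[X in _ --> X]divr1; apply: cvgM => //.
  by apply: cvgV; [exact: oner_neq0|exact: cvg_thinning_factor].
have up_near : \forall n \near \oo,
    n%:R * (thinning_factor p (theta / n%:R) - 1) <= p * theta + e.
  by apply: (@cvgr_le _ _ _ _ _ _ rcvg); rewrite ltrDl.
have low_near : \forall n \near \oo, p * theta - e <=
    n%:R * (thinning_factor p (theta / n%:R) - 1) /
    thinning_factor p (theta / n%:R).
  by apply: (@cvgr_ge _ _ _ _ _ _ rcvg'); rewrite ltrBlDr ltrDl.
near=> n.
have n0 : 0 < n%:R :> R by rewrite ltr0n; near: n; exact: nbhs_infty_gt.
have r0 := thinning_factor_gt0 (theta / n%:R) p01.
have up : n%:R * (thinning_factor p (theta / n%:R) - 1) <= p * theta + e.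
  by near: n.
have low : p * theta - e <= n%:R * (thinning_factor p (theta / n%:R) - 1) /
    thinning_factor p (theta / n%:R) by near: n.
move: r0 up low; set r := thinning_factor _ _ => r0 up low.
apply/andP; split.
  rewrite -[leRHS]invrK -[leLHS]invrK lef_pV2 ?posrE ?invr_gt0 ?expR_gt0//.
  rewrite -expRN; apply: (@le_trans _ _ (expR (r^-1 - 1))).
    by have := expR_ge1Dx (r^-1 - 1); rewrite addrCA subrr addr0.
  rewrite ler_expR lerNr opprB ler_pdivrMr// [leRHS]mulrC.
  apply: le_trans low _; rewrite -mulrA ler_wpM2l//.
  by rewrite mulrBl divff ?gt_eqF// mul1r.
apply: (@le_trans _ _ (expR (r - 1))).
  by have := expR_ge1Dx (r - 1); rewrite addrCA subrr addr0.
by rewrite ler_expR ler_pdivlMr// mulrC.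
Unshelve. all: by end_near. Qed.

(** The integral of [r^M] increases with [r], so the squeeze of the thinning
    factor carries over to the integrals; the limits of the two bounds are close
    to [f (p theta)] by continuity. *)
Lemma cvg_integral_thinning_factor (M : nat -> {RV P >-> nat}) (f : R -> R)
    (p theta : R) : 0 <= p <= 1 -> {for p * theta, continuous f} ->
  (forall u : R, (\int[P]_w (expR (u / n%:R) ^+ M n w)%:E)%E @[n --> \oo] -->
    (f u)%:E) ->
  (\int[P]_w (thinning_factor p (theta / n%:R) ^+ M n w)%:E)%E @[n --> \oo] -->
  (f (p * theta))%:E.
Proof.
move=> p01 cf Mf; set c := p * theta.
have sq (e : R) : 0 < e -> \forall n \near \oo,
    (\int[P]_w (expR ((c - e) / n%:R) ^+ M n w)%:E <=
     \int[P]_w (thinning_factor p (theta / n%:R) ^+ M n w)%:E <=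
     \int[P]_w (expR ((c + e) / n%:R) ^+ M n w)%:E)%E.
  move=> e0; near=> n.
  have /andP[l u] : expR ((c - e) / n%:R) <= thinning_factor p (theta / n%:R) <=
    expR ((c + e) / n%:R) by near: n; exact: thinning_factor_squeeze.
  rewrite !le_integral_powM ?l ?u ?expR_ge0//.
  by rewrite thinning_factor_ge0.
set u := fun n => (\int[P]_w (thinning_factor p (theta / n%:R) ^+ M n w)%:E)%E.
have close (eta : R) : 0 < eta -> \forall n \near \oo,
    ((f c - eta)%:E < u n < (f c + eta)%:E)%E.
  move=> eta0.
  have /nbhs_ballP[del /= del0 fdel] : \forall x \near c, `|f c - f x| < eta.
    by move/cvgrPdist_lt : cf; apply.
  pose e := del / 2.
  have e0 : 0 < e by rewrite divr_gt0.
  have edel : e < del by rewrite ltr_pdivrMr// ltr_pMr// ltr1n.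
  have fm : `|f c - f (c - e)| < eta.
    by apply: fdel; rewrite /ball/= opprB addrC subrK gtr0_norm.
  have fp : `|f c - f (c + e)| < eta.
    by apply: fdel; rewrite /ball/= opprD addrA subrr sub0r normrN gtr0_norm.
  near=> n.
  have /andP[lo hi] : (\int[P]_w (expR ((c - e) / n%:R) ^+ M n w)%:E <= u n <=
     \int[P]_w (expR ((c + e) / n%:R) ^+ M n w)%:E)%E by near: n; exact: sq.
  apply/andP; split.
    apply: lt_le_trans lo; near: n.
    apply: (Mf (c - e) _ (nbhs_open_ereal_gt (f := cst (f c - eta)) _)).
    by move: fm; rewrite ltr_norml /=; lra.
  apply: le_lt_trans hi _; near: n.
  apply: (Mf (c + e) _ (nbhs_open_ereal_lt (f := cst (f c + eta)) _)).
  by move: fp; rewrite ltr_norml /=; lra.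
apply/fine_cvgP; split.
  near=> n.
  have /andP[lo hi] : ((f c - 1)%:E < u n < (f c + 1)%:E)%E.
    by near: n; exact: close.
  by rewrite fin_real// (lt_trans _ lo) ?ltNyr// (lt_trans hi) ?ltry.
apply/cvgrPdist_lt => eta eta0; near=> n.
have /andP[lo hi] : ((f c - eta)%:E < u n < (f c + eta)%:E)%E.
  by near: n; exact: close.
have ufin : u n \is a fin_num.
  by rewrite fin_real// (lt_trans _ lo) ?ltNyr// (lt_trans hi) ?ltry.
rewrite /= -/(u n); move: lo hi; rewrite -(fineK ufin) !lte_fin.
by rewrite ltr_norml/=; lra.
Unshelve. all: by end_near. Qed.

End initial_customers.

(** * The fluid limit *)

Theorem theorem3p6 (R : realType) (d : measure_display) (T : measurableType d)
    (P : probability T R) (lambda mu Q0 : R)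
    (N : nat -> {RV P >-> nat}) (q : nat -> queue_input P)
    (lambda_gt0 : 0 < lambda) (mu_gt0 : 0 < mu)
    (N_iid : iid N)
    (N_integrable : P.-integrable [set: T] (fun w => ((N 0%N w)%:R : R)%:E))
    (q_queue : forall n : nat, (0 < n)%N ->
       batch_arrival_queue (n%:R * lambda) mu N (q n))
    (q_init : forall theta : R,
       ('M_P (number_in_system N (q n) 0)) (theta / n%:R) @[n --> \oo]
         --> (expR (Q0 * theta))%:E)
    (theta : R)
    (N_mgf : exists2 m : nat, (0 < m)%N &
       (('M_P (fun w => (N 0%N w)%:R : R)) (theta / m%:R) < +oo)%E)
    (t : R) (t_ge0 : 0 <= t) :
  ('M_P (number_in_system N (q n) t)) (theta / n%:R) @[n --> \oo]
    --> (expR (lambda * fine ('E_P[fun w => (N 0%N w)%:R])%E * theta / mu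
                 * (1 - expR (- (mu * t)))
               + Q0 * theta * expR (- (mu * t))))%:E.
Proof.
have [m m0 N_mgf_m] := N_mgf.
have N_exp : P.-integrable setT
    (fun w => (expR ((N 0%N w)%:R * (theta / m%:R)))%:E).
  apply/integrableP; split.
    apply/measurable_EFinP; apply: measurableT_comp => //.
    apply: measurable_funM => //.
    exact: (measurableT_comp (f := fun k : nat => k%:R : R)).
  move: N_mgf_m; rewrite /mmt_gen_fun unlock; apply: le_lt_trans.
  by under eq_integral do rewrite gee0_abs ?lee_fin ?expR_ge0//.
set EN := fine _; have ENE : EN = \int[P]_w (N 0%N w)%:R by rewrite /EN unlock.
pose p := expR (- (mu * t)).
have p01 : 0 <= p <= 1 by rewrite expRN_itv01// mulr_ge0// ltW.
pose h n := batch_pgf (N 0%N) mu theta n.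
pose int_h n := \int[@lebesgue_measure R]_(y in `[0, t]) h n y.
pose init n := (\int[P]_w
  (thinning_factor p (theta / n%:R) ^+ initial_size (q n) w)%:E)%E.
have mgfE n : (2 * m <= n)%N ->
    'M_P (number_in_system N (q n) t) (theta / n%:R) =
    (init n * (expR (lambda * (n%:R * (int_h n - t))))%:E)%E.
  move=> mn.
  have n0 : (0 < n)%N by rewrite (leq_trans _ mn)// muln_gt0.
  have ch := continuous_batch_pgf mu_gt0 m0 N_integrable N_exp mn.
  have [H [H0 dH HE]] := ex_antiderivative ch.
  have nu_gt0 : 0 < n%:R * lambda by rewrite mulr_gt0// ltr0n.
  pose H' (y : R) := n%:R * lambda * H y.
  have H'0 : H' 0 = 0 by rewrite /H' H0 mulr0.
  have dH' (y : R) : 0 <= y -> is_derive y (1 : R) H' (n%:R * lambda * h n y).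
    move=> y0; have dHy := dH y y0.
    have -> : H' = (n%:R * lambda) \*: H by exact/funext.
    exact: is_derive_eq.
  have hE (i : nat) (y : R) : 0 <= y -> (\int[P]_w
      (thinning_factor (expR (- (mu * y))) (theta / n%:R) ^+ N i w)%:E =
      (h n y)%:E)%E.
    move=> y0; rewrite -(batch_pgfE mu_gt0 m0 N_integrable N_exp mn) ger0_norm//.
    apply: integral_powM_same_law; last exact: N_iid.2.
    by apply: thinning_factor_ge0; rewrite expRN_itv01// mulr_ge0// ltW.
  rewrite (mgf_number_in_system nu_gt0 mu_gt0 (q_queue n n0) ch H'0 dH' hE t_ge0).
  congr (_ * _)%E; congr EFin; rewrite -expRD /H' HE//.
  by congr expR; rewrite /int_h /h; ring.
have init_cvg : init n @[n --> \oo] --> (expR (Q0 * (p * theta)))%:E.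
  apply: (cvg_integral_thinning_factor (f := fun u => expR (Q0 * u))) => //.
    apply: (@continuous_comp _ _ _ (fun u => Q0 * u) expR).
      by apply: cvgM => //; exact: cvg_cst.
    exact: continuous_expR.
  move=> u; apply: cvg_trans (q_init u); apply: near_eq_cvg; near=> n.
  have n0 : (0 < n)%N by near: n; exact: nbhs_infty_gt.
  rewrite (mgf_number_in_system0 _ mu_gt0 (q_queue n n0))//.
  by rewrite mulr_gt0// ltr0n.
have batch_cvg : expR (lambda * (n%:R * (int_h n - t))) @[n --> \oo] -->
    expR (lambda * (EN * theta / mu * (1 - p))).
  apply: continuous_cvg; first exact: continuous_expR.
  apply: cvgM; first exact: cvg_cst.
  rewrite ENE; exact: (cvg_Rintegral_batch_pgf mu_gt0 m0 N_integrable N_exp).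
have -> : expR (lambda * EN * theta / mu * (1 - expR (- (mu * t))) +
      Q0 * theta * expR (- (mu * t))) =
    expR (Q0 * (p * theta)) * expR (lambda * (EN * theta / mu * (1 - p))).
  by rewrite -expRD /p; congr expR; ring.
rewrite EFinM.
have : (init n * (expR (lambda * (n%:R * (int_h n - t))))%:E)%E @[n --> \oo] -->
    ((expR (Q0 * (p * theta)))%:E *
     (expR (lambda * (EN * theta / mu * (1 - p))))%:E)%E.
  apply: cvgeM => //; apply: cvg_EFin => //; exact: nearW.
apply: cvg_trans; apply: near_eq_cvg; near=> n.
rewrite mgfE//; near: n; exact: nbhs_infty_ge.
Unshelve. all: by end_near. Qed.
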